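(* Let $\vec{\mathcal H}$ be a finite sequence of conjugacy classes of finitely generated subgroups of $F(\mathcal B)$, and suppose $\mathrm{minlex}(\vec{\mathcal H}')>1$ for some (equivalently any) Gersten representative $\vec{\mathcal H}'$ of $\vec{\mathcal H}$. Then the following are equivalent: (1) there is $\alpha\in\mathrm{Aut}(F(\mathcal B))$ such that $\Sigma(\alpha\vec{\mathcal H})$ can be visibly cleaved; (2) for some Gersten representative $\vec{\mathcal H}'$ of $\vec{\mathcal H}$, $\Sigma(\vec{\mathcal H}')$ can be visibly cleaved; (3) for every Gersten representative $\vec{\mathcal H}'$ of $\vec{\mathcal H}$, $\Sigma(\vec{\mathcal H}')$ can be visibly cleaved.
   Context: $F(\mathcal B)$ is the free group on a finite set $\mathcal B$, identified with $\pi_1$ of the rose $R_{\mathcal B}$. For a conjugacy class $[[H]]$ of a finitely generated subgroup, $\Sigma([[H]])$ is the core of the covering graph of $R_{\mathcal B}$ corresponding to $H$, a finite graph with oriented edges labeled in $\mathcal B^{\pm1}$ (empty if $H=1$); for sequences, componentwise, and automorphisms act componentwise. For $b\in\mathcal B$, $n(b,\vec{\mathcal H})$ is the number of edges of $\Sigma(\vec{\mathcal H})$ labeled $b^{\pm1}$ and $\mathrm{minlex}=\min_b n(b,\cdot)$. The complexity is the total number of edges of $\Sigma(\vec{\mathcal H})$; $\vec{\mathcal H}'$ is a Gersten representative of $\vec{\mathcal H}$ if $\vec{\mathcal H}'=\beta\vec{\mathcal H}$ for some automorphism $\beta$ and has minimal complexity in the orbit $\mathrm{Aut}(F(\mathcal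 B))\vec{\mathcal H}$. A sequence $(\Sigma_i)_{i\in I}$ of labeled graphs can be visibly cleaved if there is a partition $\mathcal B=\mathcal B'\sqcup\mathcal B''$ into two nonempty sets and an index $i_0\in I$ such that $\Sigma_{i_0}$ is the wedge (union along a single common vertex) of a connected graph all of whose labels lie in $\mathcal B'^{\pm1}$ and a connected graph all of whose labels lie in $\mathcal B''^{\pm1}$, and for each $i\neq i_0$ the labels of $\Sigma_i$ all lie in $\mathcal B'^{\pm1}$ or all lie in $\mathcal B''^{\pm1}$. *)

(* Defs.v *)
From mathcomp Require Import all_boot.
Set Implicit Arguments. Unset Strict Implicit. Unset Printing Implicit Defensive.

Section FreeGroup.
Variable B : finType.

(* a letter (b, false) is b, (b, true) is b^-1 *)
Definition letter := (B * bool)%type.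
Definition word := seq letter.

Definition linv (l : letter) : letter := (l.1, ~~ l.2).
Definition winv (w : word) : word := rev (map linv w).

Definition rstep (l : letter) (acc : word) : word :=
  match acc with
  | y :: acc' => if y == linv l then acc' else l :: acc
  | [::] => [:: l]
  end.
Definition reduce (w : word) : word := foldr rstep [::] w.
Definition reduced (w : word) : bool := reduce w == w.

Definition in_sub (gens : seq word) (w : word) : Prop :=
  exists s : seq (nat * bool),
    all (fun x => x.1 < size gens) s /\
    reduce (flatten [seq if x.2 then winv (nth [::] gens x.1) else nth [::] gens x.1
                    | x <- s]) = reduce w.

Definition ext (a : B -> word) (w : word) : word :=
  reduce (flatten [seq if l.2 then winv (a l.1) else a l.1 | l <- w]).

Definition is_aut (a : B -> word) : Prop :=
  exists a' : B -> word, forall w, reduced w ->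
    ext a' (ext a w) = w /\ ext a (ext a' w) = w.

(* action of an automorphism on a sequence of f.g. subgroups (given by generators) *)
Definition aut_act (a : B -> word) (Hs : seq (seq word)) : seq (seq word) :=
  map (map (ext a)) Hs.

(* finite graphs with oriented edges (src, label, tgt), labels in B;
   vertices are 0 .. nv-1 *)
Record lgraph := LGraph { nv : nat; edges : seq (nat * B * nat) }.
Definition G0 : lgraph := LGraph 0 [::].

Definition esrc (e : nat * B * nat) := e.1.1.
Definition elab (e : nat * B * nat) := e.1.2.
Definition etgt (e : nat * B * nat) := e.2.

Definition wf_graph (G : lgraph) : bool :=
  all (fun e => (esrc e < nv G) && (etgt e < nv G)) (edges G).

Definition folded (G : lgraph) : Prop :=
  uniq (edges G) /\
  forall e1 e2, e1 \in edges G -> e2 \in edges G -> e1 != e2 ->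
    elab e1 != elab e2 \/ (esrc e1 != esrc e2 /\ etgt e1 != etgt e2).

Definition degree (G : lgraph) (x : nat) : nat :=
  count (fun e => esrc e == x) (edges G) + count (fun e => etgt e == x) (edges G).

(* walks: sequences of (edge, traversed backwards?) *)
Definition wstep (G : lgraph) (o : option nat) (s : (nat * B * nat) * bool) :=
  match o with
  | None => None
  | Some c =>
      if s.1 \in edges G then
        if ~~ s.2 then (if esrc s.1 == c then Some (etgt s.1) else None)
        else (if etgt s.1 == c then Some (esrc s.1) else None)
      else None
  end.
Definition walk_end (G : lgraph) (x : nat) (p : seq ((nat * B * nat) * bool)) :=
  foldl (wstep G) (Some x) p.
Definition walk_label (p : seq ((nat * B * nat) * bool)) : word :=
  [seq (elab s.1, s.2) | s <- p].

Definition conn_by (G : lgraph) (E : pred (nat * B * nat)) (x y : nat) : Prop :=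
  exists p, all (fun s => E s.1) p /\ walk_end G x p = Some y.

Definition connected (G : lgraph) : Prop :=
  forall x y, x < nv G -> y < nv G -> conn_by G predT x y.

Definition represents (G : lgraph) (gens : seq word) : Prop :=
  (nv G = 0 /\ forall w, in_sub gens w -> reduce w = [::]) \/
  (exists v (g : word), v < nv G /\
     forall w, reduced w ->
       ((exists p, walk_end G v p = Some v /\ reduce (walk_label p) = w)
        <-> in_sub gens (reduce (winv g ++ w ++ g)))).

Definition core_of (gens : seq word) (G : lgraph) : Prop :=
  [/\ wf_graph G, folded G, connected G,
      (forall x, x < nv G -> 1 < degree G x) & represents G gens].

Definition sigma_seq (Hs : seq (seq word)) (Gs : seq lgraph) : Prop :=
  size Gs = size Hs /\
  forall i, i < size Hs -> core_of (nth [::] Hs i) (nth G0 Gs i).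

Definition nlab (b : B) (Gs : seq lgraph) : nat :=
  sumn [seq count (fun e => elab e == b) (edges G) | G <- Gs].
Definition total_edges (Gs : seq lgraph) : nat := sumn [seq size (edges G) | G <- Gs].

Definition cplx_le (Hs1 Hs2 : seq (seq word)) : Prop :=
  forall Gs1 Gs2, sigma_seq Hs1 Gs1 -> sigma_seq Hs2 Gs2 ->
    total_edges Gs1 <= total_edges Gs2.

Definition gersten (beta : B -> word) (Hs : seq (seq word)) : Prop :=
  is_aut beta /\ forall a, is_aut a -> cplx_le (aut_act beta Hs) (aut_act a Hs).

Definition wedge (P : {set B}) (G : lgraph) : Prop :=
  exists v, v < nv G /\
    let V1 x := (x == v) || has (fun e => (elab e \in P) && ((esrc e == x) || (etgt e == x))) (edges G) in
    let V2 x := (x == v) || has (fun e => (elab e \notin P) && ((esrc e == x) || (etgt e == x))) (edges G) in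
    [/\ forall x, x < nv G -> V1 x || V2 x,
        forall x, V1 x -> V2 x -> x = v,
        forall x y, V1 x -> V1 y -> conn_by G (fun e => elab e \in P) x y &
        forall x y, V2 x -> V2 y -> conn_by G (fun e => elab e \notin P) x y].

Definition visibly_cleaved (Gs : seq lgraph) : Prop :=
  exists P : {set B}, [/\ P != set0, ~: P != set0 &
    exists i0, [/\ i0 < size Gs, wedge P (nth G0 Gs i0) &
      forall i, i < size Gs -> i != i0 ->
        all (fun e => elab e \in P) (edges (nth G0 Gs i)) \/
        all (fun e => elab e \notin P) (edges (nth G0 Gs i))]].

End FreeGroup.

(* Main.v *)
From HB Require Import structures.
Require Import Defs.
From mathcomp Require Import all_boot.
From mathcomp Require Import boolp zify.
Set Implicit Arguments. Unset Strict Implicit. Unset Printing Implicit Defensive.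

(* An automorphism moves the cone on a set D of letters (the reduced words starting in D)
   to a clopen set X of ends of the Cayley tree of F(B), that is, a sphere in the doubled
   handlebody: X is encoded by a colouring of F(B) which does not change across the edges
   far from 1 ([tame]).  A subgroup K crosses X if it has arbitrarily long elements of both
   colours.  The vertices of the core graph of H are the cosets Hg such that H^g has at
   least two initial letters, so the number of vertices having edges on both sides of the
   partition of B^{+-1} into D and its complement ([capacity D]) counts the cosets crossing
   the cone on D.  A Whitehead automorphism replaces n(a) by [capacity D] when D contains a
   but not a^-1, and increases no other n(b); hence n(a) <= [capacity D] at a Gersten
   representative.

   Let X be crossed by at most one coset, and look at it from a vertex of the tree at which
   all directions but one, a, are monochromatic, both colours occurring.  Let C be the set
   of those directions having the colour of a^-1, and C' the set of the others.  Counting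
   vertices with the inequality for C gives [capacity C' <= 1], provided that every core
   vertex meeting C and C' has an edge in the direction a; when this fails at one such
   vertex of the tree, it holds at another one, seen in the direction a.  As n(b) >= 2 for
   all b, the inequality then forces C' to be closed under inversion, and C' is a visible
   cleaving.  Moreover, erasing C' from X gives a simpler set crossed by at most one coset,
   and does not change the class of X in homology mod 2.  By induction that class vanishes.
   As the cone on a single letter does not have a trivial class in any basis, all n(b) are
   >= 2 in every basis: this is why the hypothesis on one Gersten representative suffices. *)

(** * Finite sequences *)

Section SeqFacts.

Lemma count_gt1P (T : eqType) (a : pred T) (s : seq T) : uniq s ->
  reflect (exists x y, [/\ x != y, x \in s, y \in s, a x & a y]) (1 < count a s).
Proof.
move=> us; rewrite -size_filter; apply: (iffP idP); last first.
  move=> [x [y [nxy xs ys ax ay]]]; apply: (@uniq_leq_size _ [:: x; y]).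
    by rewrite /= inE nxy.
  by move=> z; rewrite !inE mem_filter => /orP[]/eqP->; apply/andP.
have := filter_uniq a us; have := mem_filter a _ s.
case: (filter a s) => [|x [|y t]] // memE /= /andP[+ _] _.
rewrite inE negb_or => /andP[nxy _].
have /andP[ax xs] : a x && (x \in s) by rewrite -memE mem_head.
have /andP[ay ys] : a y && (y \in s) by rewrite -memE !inE eqxx orbT.
by exists x, y.
Qed.

Lemma count_le1_eq (T : eqType) (a : pred T) (s : seq T) : uniq s ->
  count a s <= 1 -> {in s &, forall x y, a x -> a y -> x = y}.
Proof.
move=> us le1 x y xs ys ax ay; apply: contraTeq le1 => nxy.
by rewrite -ltnNge; apply/count_gt1P => //; exists x, y.
Qed.

Lemma count_leq_predI (T : eqType) (a b : pred T) (s : seq T) :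
  count a s <= count (predI b a) s -> {in s, forall x, a x -> b x}.
Proof.
rewrite -count_filter -size_filter => le x xs ax.
have /allP : all b (filter a s) by rewrite all_count eqn_leq count_size.
by apply; rewrite mem_filter ax.
Qed.

Lemma leq_size_rel (T U : eqType) (s : seq T) (t : seq U) (R : T -> U -> Prop) :
  uniq s -> (forall x, x \in s -> exists2 y, y \in t & R x y) ->
  (forall x x' y, x \in s -> x' \in s -> R x y -> R x' y -> x = x') ->
  size s <= size t.
Proof.
case: s => [//|x0 s0]; set s := x0 :: s0 => us total_R inj_R.
have [y0 _ _] := total_R x0 (mem_head _ _).
have /choice[f fP] x : exists y, x \in s -> y \in t /\ R x y.
  by have [/total_R[y]|] := boolP (x \in s); [exists y | exists y0].
rewrite -(size_map f); apply: uniq_leq_size => [|_ /mapP[x /fP[ft _] ->] //].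
rewrite map_inj_in_uniq // => x x' xs x's fxx'; apply: (inj_R x x' (f x)) => //.
  by have [] := fP x xs.
by rewrite fxx'; have [] := fP x' x's.
Qed.

Lemma exists_transversal (T : eqType) (R : T -> T -> Prop) (s : seq T) :
  (forall x, R x x) -> exists t : seq T,
    [/\ {subset t <= s}, pairwise (fun x y => ~~ `[< R x y >]) t &
        forall x, x \in s -> exists2 y, y \in t & R x y].
Proof.
move=> Rxx; elim: s => [|x s [t [ts pt cov]]]; first by exists [::].
have [[y yt Rxy]|nR] := pselect (exists2 y, y \in t & R x y).
  exists t; split=> // [z /ts zs|z]; first by rewrite inE zs orbT.
  by rewrite inE => /orP[/eqP->|/cov//]; exists y.
exists (x :: t); split.
- by move=> z; rewrite !inE => /orP[->//|/ts->]; rewrite orbT.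
- rewrite pairwise_cons pt andbT; apply/allP => y yt.
  by apply/asboolPn => Rxy; apply: nR; exists y.
move=> z; rewrite inE => /orP[/eqP->|/cov[y yt Rzy]]; first by exists x; rewrite ?mem_head.
by exists y; rewrite // inE yt orbT.
Qed.

Lemma exists_max_size (T : Type) (P : seq T -> Prop) N : (exists u, P u) ->
  (forall u, P u -> size u < N) -> exists2 u, P u & forall v, P v -> size v <= size u.
Proof.
move=> [u0 Pu0] ltN; pose p n := `[< exists2 u, P u & size u = n >].
have exp : exists n, p n by exists (size u0); apply/asboolP; exists u0.
have leN n : p n -> n <= N by move=> /asboolP[v Pv <-]; apply/ltnW/ltN.
case: (ex_maxnP exp leN) => n /asboolP[u Pu <-] maxu; exists u => // v Pv.
by apply: maxu; apply/asboolP; exists v.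
Qed.

End SeqFacts.

(** * The free group on reduced words *)

Section FreeGroupType.
Variable B : finType.
Implicit Types (l m : letter B) (u v w : word B).

Definition linv_closed (C : pred (letter B)) := forall l, C l -> C (linv l).

Lemma linvK : involutive (@linv B).
Proof. by case=> b s; rewrite /linv /= negbK. Qed.

Lemma linv_neq l : linv l != l.
Proof. by case: l => b s; rewrite /linv xpair_eqE /= andbC; case: s. Qed.

Lemma linv_eq l m : (linv l == m) = (l == linv m).
Proof. by apply/eqP/eqP => [<-|->]; rewrite linvK. Qed.

Lemma winvK : involutive (@winv B).
Proof. by move=> w; rewrite /winv map_rev revK mapK //; apply: linvK. Qed.

Lemma size_winv w : size (winv w) = size w.
Proof. by rewrite /winv size_rev size_map. Qed.

Lemma winv_cons l w : winv (l :: w) = rcons (winv w) (linv l).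
Proof. by rewrite /winv /= rev_cons. Qed.

Lemma winv_rcons l w : winv (rcons w l) = linv l :: winv w.
Proof. by rewrite /winv map_rcons rev_rcons. Qed.

Let no_backtrack : rel (letter B) := fun l m => m != linv l.

Lemma sorted_reduce w : sorted no_backtrack (reduce w).
Proof.
elim: w => [//|l w] /=; rewrite -/(reduce w); case: (reduce w) => [//|m v] /= sv.
case: ifPn => [_|nm]; last by rewrite /= /no_backtrack nm.
exact: path_sorted sv.
Qed.

Lemma rstep_sorted l w : sorted no_backtrack (l :: w) -> rstep l w = l :: w.
Proof. by case: w => [//|m w] /= /andP[/negbTE-> _]. Qed.

Lemma reducedE w : reduced w = sorted no_backtrack w.
Proof.
apply/eqP/idP => [<-|]; first exact: sorted_reduce.
elim: w => [//|l w IH] sw /=; rewrite IH ?rstep_sorted //.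
exact: path_sorted sw.
Qed.

Lemma reduced_reduce w : reduced (reduce w).
Proof. by rewrite reducedE sorted_reduce. Qed.

Lemma reduce_id w : reduced w -> reduce w = w.
Proof. exact/eqP. Qed.

Lemma reduceK w : reduce (reduce w) = reduce w.
Proof. exact/reduce_id/reduced_reduce. Qed.

Lemma reduced1 l : reduced [:: l].
Proof. by rewrite reducedE. Qed.

Lemma reduced_cons2 l m w : reduced (l :: m :: w) = (m != linv l) && reduced (m :: w).
Proof. by rewrite !reducedE. Qed.

Lemma reduced_cat u v : reduced (u ++ v) -> reduced u /\ reduced v.
Proof. by rewrite !reducedE => /cat_sorted2[]. Qed.

Lemma reduced_cat_cons u l v :
  reduced (u ++ l :: v) = reduced (rcons u l) && reduced (l :: v).
Proof. by rewrite !reducedE sorted_cat_cons. Qed.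

Lemma reduced_rcons2 u m l :
  reduced (rcons (rcons u m) l) = (l != linv m) && reduced (rcons u m).
Proof. by rewrite -cats1 cat_rcons reduced_cat_cons reduced_cons2 reduced1 andbT andbC. Qed.

Lemma reduced_winv w : reduced w -> reduced (winv w).
Proof.
rewrite !reducedE /winv rev_sorted sorted_map.
by apply: sub_sorted => l m; rewrite /no_backtrack /= eq_sym linvK linv_eq.
Qed.

Lemma reduced_rstep l w : reduced w -> reduced (rstep l w).
Proof. by move=> /reduce_id {1}<-; apply: (reduced_reduce (l :: w)). Qed.

Lemma rstepK l w : reduced w -> rstep l (rstep (linv l) w) = w.
Proof.
case: w => [|m w] rw /=; first by rewrite eqxx.
rewrite linvK; case: eqP => [ml|_] /=; last by rewrite eqxx.
by move: rw; rewrite ml reducedE; apply: rstep_sorted.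
Qed.

Lemma reduce_cat u v : reduce (u ++ v) = foldr (@rstep B) (reduce v) u.
Proof. by rewrite /reduce foldr_cat. Qed.

Lemma foldr_rstep_reduce u w : reduced w ->
  foldr (@rstep B) w (reduce u) = foldr (@rstep B) w u.
Proof.
move=> rw; elim: u => [//|l u IH] /=; rewrite -IH -/(reduce u).
case: (reduce u) => [//|m v] /=; case: ifP => [/eqP->|//].
by rewrite rstepK //; elim: v => [//|k v IHv] /=; apply: reduced_rstep.
Qed.

Lemma reduce_catr u v : reduce (u ++ reduce v) = reduce (u ++ v).
Proof. by rewrite !reduce_cat reduceK. Qed.

Lemma reduce_catl u v : reduce (reduce u ++ v) = reduce (u ++ v).
Proof. by rewrite !reduce_cat foldr_rstep_reduce ?reduced_reduce. Qed.

Lemma reduce_winvl w : reduce (winv w ++ w) = [::].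
Proof.
elim: w => [//|l w IH]; rewrite winv_cons cat_rcons -reduce_catr /=.
by rewrite -{2}(linvK l) rstepK ?reduced_reduce // reduce_catr.
Qed.

Record free_group := FreeGroup { free_word : word B; _ : reduced free_word }.
HB.instance Definition _ := [isSub for free_word].
HB.instance Definition _ := [Choice of free_group by <:].

Definition wordg w : free_group := Sub (reduce w) (reduced_reduce w).

Lemma val_wordg w : val (wordg w) = reduce w. Proof. by []. Qed.

Lemma val_wordgK : cancel val wordg.
Proof. by move=> g; apply/val_inj/reduce_id/(valP g). Qed.

Let mul (g h : free_group) : free_group := wordg (val g ++ val h).
Let inv (g : free_group) : free_group := wordg (winv (val g)).

Fact free_mulA : associative mul.
Proof. by move=> x y z; apply: val_inj; rewrite /= reduce_catr reduce_catl catA. Qed.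
Fact free_mul1g : left_id (wordg [::]) mul.
Proof. exact: val_wordgK. Qed.
Fact free_mulg1 : right_id (wordg [::]) mul.
Proof. by move=> x; rewrite /mul cats0 val_wordgK. Qed.
Fact free_mulVg : left_inverse (wordg [::]) inv mul.
Proof. by move=> x; apply: val_inj; rewrite /= reduce_catl reduce_winvl. Qed.
Fact free_mulgV : right_inverse (wordg [::]) inv mul.
Proof.
move=> x; apply: val_inj; rewrite /= reduce_catr.
by rewrite -{1}(winvK (val x)) reduce_winvl.
Qed.

HB.instance Definition _ := isGroup.Build free_group
  free_mulA free_mul1g free_mulg1 free_mulVg free_mulgV.

Local Open Scope group_scope.
Implicit Types g h k : free_group.

Lemma reduced_val g : reduced (val g). Proof. exact: valP. Qed.

Lemma val_mul g h : val (g * h) = reduce (val g ++ val h). Proof. by []. Qed.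

Lemma val_inv g : val g^-1 = winv (val g).
Proof. exact/reduce_id/reduced_winv/reduced_val. Qed.

Lemma val_mul_reduced g h : reduced (val g ++ val h) -> val (g * h) = val g ++ val h.
Proof. exact: reduce_id. Qed.

Lemma val_wordg_reduced w : reduced w -> val (wordg w) = w.
Proof. exact: reduce_id. Qed.

Lemma wordg_nil : wordg [::] = 1. Proof. by []. Qed.

Lemma wordg_cat u v : wordg (u ++ v) = wordg u * wordg v.
Proof. by apply: val_inj; rewrite /= reduce_catl reduce_catr. Qed.

Lemma wordg_winv w : wordg (winv w) = (wordg w)^-1.
Proof.
apply: (mulIg (wordg w)); rewrite mulVg -wordg_cat; apply: val_inj.
exact: reduce_winvl.
Qed.

Definition letterg l : free_group := wordg [:: l].

Lemma val_letterg l : val (letterg l) = [:: l]. Proof. by []. Qed.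

Lemma letterg_linv l : letterg (linv l) = (letterg l)^-1.
Proof. by rewrite /letterg -wordg_winv. Qed.

Lemma wordg_cons l w : wordg (l :: w) = letterg l * wordg w.
Proof. by rewrite -cat1s wordg_cat. Qed.

Lemma wordg_rcons l w : wordg (rcons w l) = wordg w * letterg l.
Proof. by rewrite -cats1 wordg_cat. Qed.

Lemma free_group_ind (P : free_group -> Prop) :
  P 1 -> (forall g l, P g -> P (g * letterg l)) -> forall g, P g.
Proof.
move=> P1 PM g; rewrite -(val_wordgK g).
by elim/last_ind: (val g) => [//|w l IH]; rewrite wordg_rcons; apply: PM.
Qed.

Lemma mul_lettergP g l : val (g * letterg l) = rcons (val g) l \/
  val g = rcons (val (g * letterg l)) (linv l).
Proof.
case/lastP E: (val g) => [|w m]; first by left; rewrite val_mul E.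
have [em|nm] := eqVneq l (linv m).
  right; rewrite -(val_wordgK g) E wordg_rcons em letterg_linv mulgK linvK.
  have /reduced_cat[rw _] : reduced (w ++ [:: m]) by rewrite cats1 -E reduced_val.
  by rewrite val_wordg_reduced.
left; rewrite -E -cats1 -(val_letterg l) val_mul_reduced // val_letterg cats1 E.
by rewrite reduced_rcons2 nm -E reduced_val.
Qed.

End FreeGroupType.

(** * Almost all elements of the free group *)

Section AlmostAll.
Variable B : finType.
Local Open Scope group_scope.
Implicit Types (l m : letter B) (g h : free_group B) (P Q : free_group B -> Prop).
Implicit Types (f : free_group B -> free_group B).

Definition len g := size (val g).

Lemma lenV g : len g^-1 = len g.
Proof. by rewrite /len val_inv size_winv. Qed.

Lemma size_reduce (w : word B) : size (reduce w) <= size w.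
Proof.
elim: w => [//|l w IH] /=; rewrite -/(reduce w).
by case: (reduce w) IH => [//|m v] /=; case: ifP => _ /=; rewrite ?ltnS // => /ltnW/leqW.
Qed.

Lemma len_mul g h : len (g * h) <= len g + len h.
Proof. by rewrite (leq_trans (size_reduce _)) // size_cat. Qed.

(* The balls being finite, the exceptions are finitely many. *)
Definition almost_all P := exists M, forall g, M <= len g -> P g.
Definition infinitely_many P := forall M, exists2 g, M <= len g & P g.

Lemma almost_allW P Q : (forall g, P g -> Q g) -> almost_all P -> almost_all Q.
Proof. by move=> PQ [M PM]; exists M => g /PM/PQ. Qed.

Lemma almost_all_forall (T : finType) (P : T -> free_group B -> Prop) :
  (forall t, almost_all (P t)) -> almost_all (fun g => forall t, P t g).
Proof.
move=> /choice[f Pf]; exists (\max_t f t) => g le t; apply: Pf.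
by apply: leq_trans le; apply: (leq_bigmax t).
Qed.

Lemma almost_all_and P Q : almost_all P -> almost_all Q -> almost_all (fun g => P g /\ Q g).
Proof.
move=> [M PM] [N QN]; exists (maxn M N) => g; rewrite geq_max => /andP[leM leN].
by split; [apply: PM | apply: QN].
Qed.

Lemma almost_all_mp P Q : almost_all (fun g => P g -> Q g) -> almost_all P -> almost_all Q.
Proof. by move=> PQ /(almost_all_and PQ); apply: almost_allW => g []; apply. Qed.

Lemma almost_all_longer n : almost_all (fun g => n < len g).
Proof. by exists n.+1. Qed.

Lemma infinitely_manyP P : infinitely_many P <-> ~ almost_all (fun g => ~ P g).
Proof.
split=> [infP [M nP]|nP M]; first by have [g /nP] := infP M.
apply: contrapT => none; apply: nP; exists M => g lg Pg.
by apply: none; exists g.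
Qed.

Lemma not_infinitely_many P : ~ infinitely_many P <-> almost_all (fun g => ~ P g).
Proof.
split=> [nP|nP /infinitely_manyP//].
by apply: contrapT => no; apply/nP/infinitely_manyP.
Qed.

Lemma infinitely_many_sub P Q :
  almost_all (fun g => P g -> Q g) -> infinitely_many P -> infinitely_many Q.
Proof.
move=> PQ /infinitely_manyP infP; apply/infinitely_manyP => nQ; apply: infP.
by apply: almost_all_mp nQ; apply: almost_allW PQ => g PQg nQ /PQg.
Qed.

Lemma infinitely_manyW P Q :
  (forall g, P g -> Q g) -> infinitely_many P -> infinitely_many Q.
Proof. by move=> PQ; apply: infinitely_many_sub; exists 0 => g _; apply: PQ. Qed.

Lemma infinitely_many_exists (T : finType) (P : T -> free_group B -> Prop) :
  infinitely_many (fun g => exists t, P t g) -> exists t, infinitely_many (P t).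
Proof.
move=> /infinitely_manyP infP; apply: contrapT => /forallNP no; apply: infP.
have := almost_all_forall (fun t => (not_infinitely_many _).1 (no t)).
by apply: almost_allW => g nP [t /nP].
Qed.

Lemma infinitely_many_or P Q : infinitely_many (fun g => P g \/ Q g) ->
  infinitely_many P \/ infinitely_many Q.
Proof.
move=> PQ; have [|[] inf] := @infinitely_many_exists bool (fun b => if b then P else Q).
- by apply: infinitely_manyW PQ => g [Pg|Qg]; [exists true | exists false].
- by left.
by right.
Qed.

Definition proper_map f := forall M, almost_all (fun g => M <= len (f g)).

Lemma almost_all_comp f P : proper_map f -> almost_all P -> almost_all (P \o f).
Proof. by move=> pf [M PM]; apply: almost_allW (pf M) => g; apply: PM. Qed.

Lemma infinitely_many_comp f P : proper_map f -> infinitely_many (P \o f) -> infinitely_many P.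
Proof.
move=> pf /infinitely_manyP infP; apply/infinitely_manyP => nP; apply: infP.
exact: almost_all_comp nP.
Qed.

Lemma proper_mull h : proper_map ( *%g h).
Proof.
move=> M; exists (M + len h) => g le; rewrite -(leq_add2r (len h)) (leq_trans le) //.
by rewrite -{1}(mulKg h g) (leq_trans (len_mul _ _)) // lenV addnC.
Qed.

Lemma proper_mulr h : proper_map ( *%g^~ h).
Proof.
move=> M; exists (M + len h) => g le; rewrite -(leq_add2r (len h)) (leq_trans le) //.
by rewrite -{1}(mulgK h g) (leq_trans (len_mul _ _)) // lenV.
Qed.

Lemma proper_conjg h : proper_map (conjg^~ h).
Proof. by move=> M; exact: (almost_all_comp (proper_mulr h) (proper_mull h^-1 M)). Qed.

End AlmostAll.

(** * Colourings of the Cayley tree *)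

Section Cones.
Variable B : finType.
Local Open Scope group_scope.
Implicit Types (l m : letter B) (u v w : word B) (g h p : free_group B).
Implicit Types (Q : pred (letter B)) (X Y : pred (free_group B)).

Definition starts u g := prefix u (val g).

Lemma starts1E l m w g : val g = l :: w -> starts [:: m] g = (m == l).
Proof. by rewrite /starts => ->; rewrite prefix_cons prefix0s andbT. Qed.

Lemma starts1_eq l m g : starts [:: l] g -> starts [:: m] g = (m == l).
Proof. by case/prefixP=> w /starts1E. Qed.

Lemma starts_head u l g : starts (rcons u l) g -> starts [:: head l u] g.
Proof.
case/prefixP=> w gE; rewrite (@starts1E (head l u) _ (behead (rcons u l) ++ w)) //.
by rewrite gE; case: (u).
Qed.

Lemma reduced_starts u g : starts u g -> reduced u.
Proof. by case/prefixP=> v gE; have := reduced_val g; rewrite gE => /reduced_cat[]. Qed.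

Lemma starts_next u g : starts u g -> size u < len g -> exists l, starts (rcons u l) g.
Proof.
rewrite /len => /prefixP[[|l v] gE]; first by rewrite gE cats0 ltnn.
by exists l; apply/prefixP; exists v; rewrite gE cat_rcons.
Qed.

Lemma startsW u v g : starts (u ++ v) g -> starts u g.
Proof. exact: catl_prefix. Qed.

Lemma starts_val_split p g : starts (val p) g -> val g = val p ++ val (p^-1 * g).
Proof.
case/prefixP=> v gE; rewrite gE; congr (_ ++ _).
have /reduced_cat[_ rv] : reduced (val p ++ v) by rewrite -gE reduced_val.
by rewrite -(val_wordgK g) gE wordg_cat val_wordgK mulKg val_wordg_reduced.
Qed.

Lemma starts_letter_mulV p l g : reduced (rcons (val p) l) ->
  starts [:: l] (p^-1 * g) = starts (rcons (val p) l) g.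
Proof.
move=> rl; apply/idP/idP => [/prefixP[v pgE]|sl].
  apply/prefixP; exists v; rewrite cat_rcons -cat1s -pgE -val_mul_reduced ?mulVKg //.
  by rewrite pgE reduced_cat_cons rl -[_ :: _]pgE reduced_val.
have sp : starts (val p) g by move: sl; rewrite -cats1 => /startsW.
by move: sl; rewrite /starts (starts_val_split sp) -cats1 prefix_catr // eqxx.
Qed.

(* The edge from [p] back towards [1] cuts the tree into the words that start with [p]
   and all the others. *)
Lemma starts_last_mulV p u m g : val p = rcons u m ->
  starts [:: linv m] (p^-1 * g) = ~~ starts (val p) g.
Proof.
move=> pE; apply/idP/idP => [/prefixP[v pgE]|].
  apply/negP => /starts_val_split gE; have := reduced_val g.
  by rewrite gE pE pgE -cats1 -catA => /reduced_cat[_]; rewrite /= reduced_cons2 eqxx.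
apply: contraNT => nm; apply/prefixP; exists (val (p^-1 * g)).
rewrite -val_mul_reduced ?mulVKg //; case pgE: (val (p^-1 * g)) => [|l v].
  by rewrite cats0 reduced_val.
rewrite pE reduced_cat_cons reduced_rcons2 -pE reduced_val -pgE reduced_val !andbT.
by move: nm; rewrite /starts pgE prefix_cons prefix0s andbT eq_sym.
Qed.

Lemma infinitely_many_starts1 l : infinitely_many (starts [:: l]).
Proof.
move=> M; have rl : reduced (nseq M.+1 l).
  elim: M => [|M IH]; first exact: reduced1.
  by rewrite /= reduced_cons2 eq_sym linv_neq.
exists (wordg (nseq M.+1 l)); first by rewrite /len val_wordg_reduced // size_nseq.
by apply/prefixP; exists (nseq M l); rewrite val_wordg_reduced.
Qed.

Definition cone Q g : bool := if val g is l :: _ then Q l else false.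

Lemma coneE Q g : cone Q g = [exists l, Q l && starts [:: l] g].
Proof.
rewrite /cone; case gE: (val g) => [|l w].
  by apply/esym/existsP => -[l]; rewrite /starts gE andbF.
apply/idP/existsP => [Ql|[m]]; first by exists l; rewrite Ql (starts1E _ gE) eqxx.
by rewrite (starts1E _ gE) => /andP[Qm /eqP <-].
Qed.

Lemma cone_starts Q l g : starts [:: l] g -> cone Q g = Q l.
Proof. by rewrite /cone => /prefixP[v ->]. Qed.

Lemma cone1 l g : cone (pred1 l) g = starts [:: l] g.
Proof.
rewrite /cone; case gE: (val g) => [|m w]; first by rewrite /starts gE.
by rewrite (starts1E _ gE) eq_sym.
Qed.

Lemma cone_predC Q : almost_all (fun g => cone (predC Q) g = ~~ cone Q g).
Proof. by exists 1%N => g; rewrite /len /cone; case: (val g). Qed.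

Lemma cone_mul_letterg Q g l : cone Q (g * letterg l) =
  cone Q g (+) ((g == 1) && Q l) (+) ((g * letterg l == 1) && Q (linv l)).
Proof.
have eq1 h : (h == 1) = (val h == [::]) by [].
rewrite !eq1 /cone; case: (mul_lettergP g l) => ->.
  by case: (val g) => [|m [|k s]] /=; rewrite ?addbF ?addFb ?andbF ?addbF.
by case: (val (g * letterg l)) => [|m s] /=; rewrite ?addbF ?addFb ?addbb.
Qed.

Lemma starts1_mul_letterg m g l : starts [:: m] (g * letterg l) =
  starts [:: m] g (+) ((g == 1) && (l == m)) (+) ((g * letterg l == 1) && (linv l == m)).
Proof. by rewrite -!cone1 cone_mul_letterg. Qed.

Lemma starts1_mul_other m g l :
  l.1 != m.1 -> starts [:: m] (g * letterg l) = starts [:: m] g.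
Proof.
move=> nlm; rewrite starts1_mul_letterg.
have [/negbTE-> /negbTE->] : l != m /\ linv l != m by split; apply: contraNneq nlm => <-.
by rewrite !andbF !addbF.
Qed.

(* A colouring is determined by the edges of the Cayley tree across which it changes. *)
Lemma cone_unique Q Y : Y 1 = false ->
  (forall g l, Y (g * letterg l) =
     Y g (+) ((g == 1) && Q l) (+) ((g * letterg l == 1) && Q (linv l))) ->
  Y =1 cone Q.
Proof.
move=> Y1 Ymul; elim/free_group_ind => [//|g l IH].
by rewrite Ymul IH cone_mul_letterg.
Qed.

(* Far from [1] the colour of [X] does not change across edges: [X] extends to a clopen
   set of ends of the Cayley tree. *)
Definition tame X := almost_all (fun g => forall l, X (g * letterg l) = X g).

Lemma tame_mulr X h : tame X -> almost_all (fun g => X (g * h) = X g).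
Proof.
move=> tX; elim/free_group_ind: h => [|h l IH]; first by exists 0 => g; rewrite mulg1.
have := almost_all_and (almost_all_comp (proper_mulr h) tX) IH.
by apply: almost_allW => g /= [/(_ l)]; rewrite mulgA => -> ->.
Qed.

Lemma tame_mull X y : tame X -> tame (fun g => X (y * g)).
Proof.
move=> /(almost_all_comp (proper_mull y)); apply: almost_allW => g /= tX l.
by rewrite mulgA.
Qed.

Lemma tame_starts u : tame (starts u).
Proof.
have prefix_rconsE (s : word B) m : size u <= size s -> prefix u (rcons s m) = prefix u s.
  by move=> le; rewrite !prefixE -cats1 takel_cat.
exists (size u).+1 => g lu l; rewrite /starts; move: lu; rewrite /len.
case: (mul_lettergP g l) => ->; first by move/ltnW/prefix_rconsE.
by rewrite size_rcons ltnS => /prefix_rconsE.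
Qed.

Lemma tame_cone Q : tame (cone Q).
Proof.
apply: almost_allW (almost_all_forall (fun l => tame_starts [:: l])) => g sg l.
by rewrite !coneE; apply: eq_existsb => m; rewrite sg.
Qed.

Lemma tame_starts_const X : tame X ->
  exists N, forall u g, N <= size u -> starts u g -> X g = X (wordg u).
Proof.
move=> [N tX]; exists N => u g Nu /prefixP[v gE].
have := reduced_val g; rewrite -{2}(val_wordgK g) gE => {g gE}.
elim/last_ind: v => [|v l IH] r; first by rewrite cats0.
have [rv _] : reduced (u ++ v) /\ reduced [:: l].
  by apply: reduced_cat; rewrite cats1 rcons_cat.
rewrite -rcons_cat wordg_rcons tX ?IH //.
by rewrite /len val_wordg_reduced // size_cat (leq_trans Nu) // leq_addr.
Qed.

End Cones.

(** * Limit sets of subgroups *)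

Section SubgroupPredicates.
Variable gT : groupType.
Local Open Scope group_scope.
Implicit Types (g h k : gT) (K : gT -> Prop).

Definition subgroup K :=
  [/\ K 1, forall g h, K g -> K h -> K (g * h) & forall g, K g -> K g^-1].

Definition conjugate K g : gT -> Prop := fun k => K (k ^ g^-1).
Local Notation "K :^ g" := (conjugate K g) (at level 35, right associativity).

Lemma conjugateM K g h : (K :^ g) :^ h = K :^ (g * h).
Proof. by apply: funext => k; rewrite /conjugate invgM conjgM. Qed.

Lemma conjugate1 K : K :^ 1 = K.
Proof. by apply: funext => k; rewrite /conjugate invg1 conjg1. Qed.

Lemma subgroup_conjugate K g : subgroup K -> subgroup (K :^ g).
Proof.
case=> K1 KM KV; split=> [|h k Kh Kk|h Kh]; rewrite /conjugate.
- by rewrite conj1g.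
- by rewrite conjMg; apply: KM.
by rewrite conjVg; apply: KV.
Qed.

Lemma subgroupX K k n : subgroup K -> K k -> K (k ^+ n).
Proof. by case=> K1 KM _ Kk; elim: n => [//|n IH]; rewrite expgS; apply: KM. Qed.

Lemma conjugate_mulr_mem K g k : subgroup K -> K k -> K :^ (k * g) = K :^ g.
Proof.
move=> [_ KM KV] Kk; apply: funext => h; rewrite /conjugate invgM conjgM !conjgE invgK.
set h' := (_ * _); apply: propext; split=> Kh; last by apply/KM/KM/KV.
by have := KM _ _ (KV _ Kk) (KM _ _ Kh Kk); rewrite -!mulgA mulVg mulg1 mulKg.
Qed.

End SubgroupPredicates.

Local Notation "K :^ g" := (conjugate K g) (at level 35, right associativity).

Section Subgroups.
Variable B : finType.
Local Open Scope group_scope.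
Implicit Types (l m : letter B) (u v w : word B) (g h k p y : free_group B).
Implicit Types (Q : pred (letter B)) (X Y : pred (free_group B)) (K : free_group B -> Prop).

(* The limit set of [K] meets the clopen set of ends given by [X]. *)
Definition meets K X := infinitely_many (fun g => K g /\ X g).
Definition crosses K X := forall c, meets K (fun g => X g == c).
Definition direction K l := meets K (starts [:: l]).
(* The vertex [g] lies in the convex hull of the limit set of [K] exactly when
   [K :^ g] has two directions. *)
Definition two_directions K := exists l m, [/\ l != m, direction K l & direction K m].

Lemma meets_sub K X Y : almost_all (fun g => X g -> Y g) -> meets K X -> meets K Y.
Proof.
by move=> XY; apply: infinitely_many_sub; apply: almost_allW XY => g XYg [Kg /XYg].
Qed.

Lemma eq_meets K X Y : almost_all (fun g => X g = Y g) -> meets K X <-> meets K Y.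
Proof. by move=> XY; split; apply: meets_sub; apply: almost_allW XY => g ->. Qed.

Lemma meets_cone K Q : meets K (cone Q) <-> exists2 l, Q l & direction K l.
Proof.
split=> [KQ|[l Ql]]; last first.
  by apply: meets_sub; exists 0 => g _ /cone_starts ->.
have [|l Kl] := @infinitely_many_exists B _ (fun l g => [/\ K g, Q l & starts [:: l] g]).
  apply: infinitely_manyW KQ => g [Kg]; rewrite coneE.
  by case/existsP=> l /andP[]; exists l.
exists l; last by apply: infinitely_manyW Kl => g [].
by have [g _ []] := Kl 0.
Qed.

Lemma crosses_cone K Q : crosses K (cone Q) <->
  exists l m, [/\ Q l, ~~ Q m, direction K l & direction K m].
Proof.
have crossesE : crosses K (cone Q) <-> meets K (cone Q) /\ meets K (cone (predC Q)).
  have false_predC : almost_all (fun g => (cone Q g == false) = cone (predC Q) g).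
    by apply: almost_allW (cone_predC Q) => g ->; rewrite eqbF_neg.
  have true_cone : almost_all (fun g => (cone Q g == true) = cone Q g).
    by exists 0 => g _; rewrite eqb_id.
  rewrite -(eq_meets K true_cone) -(eq_meets K false_predC).
  by split=> [crossQ|[+ +] []]; [split; apply: crossQ | |].
rewrite crossesE !meets_cone.
split=> [[[l Ql Kl] [m Qm Km]]|[l [m [Ql Qm Kl Km]]]]; first by exists l, m.
by split; [exists l | exists m].
Qed.

Lemma meets_conjugate K X y : tame X ->
  meets (K :^ y) (fun g => X (y * g)) <-> meets K X.
Proof.
move=> tX.
have XE : almost_all (fun g => X (g ^ y^-1) = X (y * g)).
  have := almost_all_comp (proper_mull y) (tame_mulr y^-1 tX).
  by apply: almost_allW => g /=; rewrite conjgE invgK mulgA.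
rewrite -(eq_meets _ XE); split => [|KX].
  exact: (@infinitely_many_comp _ _ (fun g => K g /\ X g) (proper_conjg y^-1)).
apply: (infinitely_many_comp (proper_conjg y)); apply: infinitely_manyW KX => g /=.
by rewrite /conjugate conjgK.
Qed.

Lemma crosses_conjugate K X y : tame X ->
  crosses (K :^ y) (fun g => X (y * g)) <-> crosses K X.
Proof.
move=> tX; have tXc c : tame (fun g => X g == c).
  by apply: almost_allW tX => g tX l; rewrite tX.
by split=> crossX c; apply/(meets_conjugate K y (tXc c))/crossX.
Qed.

Lemma direction_conjugate K p l :
  direction (K :^ p) l <-> meets K (fun g => starts [:: l] (p^-1 * g)).
Proof.
rewrite -(meets_conjugate K p (tame_mull p^-1 (tame_starts [:: l]))).
by apply: eq_meets; exists 0 => g _; rewrite mulKg.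
Qed.

Lemma direction_next K p l : reduced (rcons (val p) l) ->
  direction (K :^ p) l <-> meets K (starts (rcons (val p) l)).
Proof.
move=> rl; rewrite direction_conjugate; apply: eq_meets; exists 0 => g _.
exact: starts_letter_mulV.
Qed.

Lemma direction_last K p u m : val p = rcons u m ->
  direction (K :^ p) (linv m) <-> meets K (fun g => ~~ starts (val p) g).
Proof.
move=> pE; rewrite direction_conjugate; apply: eq_meets; exists 0 => g _.
exact: starts_last_mulV pE.
Qed.

Lemma direction_away K l p u m : direction K l -> val p = rcons u m ->
  head m u != l -> direction (K :^ p) (linv m).
Proof.
move=> Kl pE nl; rewrite (direction_last _ pE); apply: meets_sub Kl.
exists 0 => g _ lg; apply: contra nl; rewrite pE => /starts_head.
by rewrite (starts1_eq _ lg).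
Qed.

Lemma two_directions_next K p : two_directions (K :^ p) ->
  exists l, meets K (starts (rcons (val p) l)).
Proof.
move=> [l [m [nlm Kl Km]]].
suff [q rq Kq] : exists2 q, reduced (rcons (val p) q) & direction (K :^ p) q.
  by exists q; apply/direction_next.
case/lastP E: (val p) => [|u n]; first by exists l; rewrite // reduced1.
have ru : reduced (rcons u n) by rewrite -E reduced_val.
have [el|nl] := eqVneq l (linv n); last by exists l; rewrite // reduced_rcons2 nl.
by exists m; rewrite // reduced_rcons2 -el eq_sym nlm.
Qed.

Lemma two_directions_last K p u m : two_directions K -> val p = rcons u m ->
  direction (K :^ p) (linv m).
Proof.
move=> [l [l' [nl Kl Kl']]] pE.
have [hl|nhl] := eqVneq (head m u) l; last exact: direction_away Kl pE nhl.
by apply: direction_away Kl' pE _; rewrite hl.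
Qed.

Lemma two_directions_convex K u v : reduced (u ++ v) -> two_directions K ->
  two_directions (K :^ wordg (u ++ v)) -> two_directions (K :^ wordg u).
Proof.
case/lastP: u => [|u m]; first by rewrite wordg_nil conjugate1.
case: v => [|l v]; first by rewrite cats0.
move=> r dirK dirKuv; have [ru rv] := reduced_cat r.
exists (linv m), l; split.
- by move: r; rewrite reduced_cat_cons reduced_rcons2 eq_sym => /andP[/andP[]].
- by apply: two_directions_last dirK _; rewrite val_wordg_reduced.
have := @two_directions_last _ (wordg (winv (l :: v))) (winv v) (linv l) dirKuv.
rewrite linvK val_wordg_reduced ?reduced_winv // winv_cons => /(_ erefl).
by rewrite conjugateM wordg_cat -winv_cons wordg_winv mulgK.
Qed.

Lemma reduced_flatten_nseq w n : reduced (w ++ w) -> reduced (flatten (nseq n w)).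
Proof.
move=> rww; case: w rww => [|l w] rww; first by elim: n.
move: (rww); rewrite (reduced_cat_cons (l :: w) l w) => /andP[rl rw].
elim: n => [//|[|n] IH]; first by rewrite /= cats0.
rewrite -[flatten _]/((l :: w) ++ l :: (w ++ flatten (nseq n (l :: w)))).
by rewrite reduced_cat_cons rl.
Qed.

Lemma val_expg k n : reduced (val k ++ val k) ->
  val (k ^+ n) = flatten (nseq n (val k)).
Proof.
move=> rkk; elim: n => [//|n IH]; rewrite expgS val_mul_reduced IH //.
exact: (reduced_flatten_nseq n.+1).
Qed.

Lemma direction_cyclically_reduced K k l : subgroup K -> K k ->
  reduced (val k ++ val k) -> starts [:: l] k -> direction K l.
Proof.
move=> sK Kk rkk /prefixP[w kE] M; exists (k ^+ M.+1).
  rewrite /len val_expg // size_flatten /shape map_nseq sumn_nseq kE /=; lia.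
split; first exact: subgroupX.
by rewrite (@starts1E _ l l (w ++ flatten (nseq M (val k)))) // val_expg //= kE.
Qed.

Lemma two_directions_cyclically_reduced K k : subgroup K -> K k -> k != 1 ->
  reduced (val k ++ val k) -> two_directions K.
Proof.
move=> sK Kk k1 rkk; have [_ _ KV] := sK.
case/lastP kE: (val k) k1 => [|u m] k1; first by case/eqP: k1; apply: val_inj.
have rVV : reduced (val k^-1 ++ val k^-1).
  by move: (reduced_winv rkk); rewrite val_inv /winv map_cat rev_cat.
exists (head m u), (linv m); split.
- move: rkk; rewrite kE; case: u {kE} => [|l u]; first by rewrite /= eq_sym linv_neq.
  by rewrite {2}rcons_cons reduced_cat_cons reduced_rcons2 => /andP[/andP[]].
- apply: direction_cyclically_reduced rkk _ => //.
  by rewrite (@starts1E _ (head m u) _ (behead (rcons u m))) // kE; case: (u).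
apply: direction_cyclically_reduced (KV _ Kk) rVV _ => //.
by rewrite (@starts1E _ (linv m) _ (winv u)) // val_inv kE winv_rcons.
Qed.

(* A shortest conjugate of [k] is cyclically reduced. *)
Lemma exists_two_directions K k : subgroup K -> K k -> k != 1 ->
  exists g, two_directions (K :^ g).
Proof.
have [n] := ubnP (len k); elim: n => // n IH in K k *; rewrite ltnS => lk sK Kk k1.
have [rkk|nrkk] := boolP (reduced (val k ++ val k)).
  by exists 1; rewrite conjugate1; apply: two_directions_cyclically_reduced rkk.
case kE: (val k) nrkk => [|l w]; first by rewrite reducedE.
rewrite reduced_cat_cons -kE reduced_val andbT kE.
case/lastP: w kE => [|w m] kE; first by rewrite /= reduced_cons2 reduced1 eq_sym linv_neq.
rewrite -rcons_cons reduced_rcons2 rcons_cons -kE reduced_val andbT negbK => /eqP lm.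
have kJ : k ^ letterg l = wordg w.
  rewrite -(val_wordgK k) kE wordg_cons wordg_rcons lm letterg_linv conjgE invgK.
  by rewrite !mulgA mulgV mul1g mulgK.
have [||||g Kg] := IH (K :^ letterg l) (k ^ letterg l).
- rewrite kJ (leq_ltn_trans (size_reduce _)) // (leq_trans _ lk) //.
  by rewrite /len kE /= size_rcons.
- exact: subgroup_conjugate.
- by rewrite /conjugate conjgK.
- by rewrite conjg_eq1.
by exists (letterg l * g); rewrite -conjugateM.
Qed.

End Subgroups.

(** * Automorphisms *)

Local Notation endomorphism B := (UMagmaMorphism.type (free_group B) (free_group B)).

Section Automorphisms.
Variable B : finType.
Local Open Scope group_scope.
Implicit Types (g k : free_group B) (X : pred (free_group B)) (K : free_group B -> Prop).
Implicit Types f : endomorphism B.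

Lemma len_morphism f : exists M, forall g, len (f g) <= M * len g.
Proof.
exists (\max_l len (f (letterg l))) => g; rewrite -{1}(val_wordgK g) /len.
elim: (val g) => [|l w IH]; first by rewrite wordg_nil gmulf1.
rewrite wordg_cons gmulfM mulnS (leq_trans (len_mul _ _)) // leq_add //.
exact: (leq_bigmax l).
Qed.

Lemma proper_cancel f f' : cancel f f' -> proper_map f.
Proof.
move=> fK M; have [N leN] := len_morphism f'.
exists (N * M).+1 => g lg; rewrite leqNgt; apply/negP => ltM.
have := leN (f g); rewrite fK => le; have := leq_trans lg le.
by rewrite ltnNge leq_mul2l (ltnW ltM) orbT.
Qed.

Lemma tame_morphism f f' X : cancel f f' -> tame X -> tame (X \o f).
Proof.
move=> fK tX.
have tXl (l : letter B) : almost_all (fun g => X (f g * f (letterg l)) = X (f g)).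
  exact: almost_all_comp (proper_cancel fK) (tame_mulr _ tX).
by apply: almost_allW (almost_all_forall tXl) => g Xg l; rewrite /= gmulfM Xg.
Qed.

Lemma meets_morphism f f' K X : cancel f f' -> cancel f' f ->
  meets (K \o f') X <-> meets K (X \o f).
Proof.
move=> fK f'K; split=> KX.
  apply: (infinitely_many_comp (proper_cancel f'K)).
  by apply: infinitely_manyW KX => g /=; rewrite f'K.
apply: (infinitely_many_comp (proper_cancel fK)).
by apply: infinitely_manyW KX => g /=; rewrite fK.
Qed.

Lemma crosses_morphism f f' K X : cancel f f' -> cancel f' f ->
  crosses (K \o f') X <-> crosses K (X \o f).
Proof.
by move=> fK f'K; split=> crossX c; apply/(meets_morphism K (fun g => X g == c) fK f'K)/crossX.
Qed.

Lemma conjugate_morphism f K g : (K \o f) :^ g = (K :^ f g) \o f.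
Proof. by apply: funext => k; rewrite /conjugate /= gmulfJ gmulfV. Qed.

End Automorphisms.

(** * Reading words in labelled graphs *)

Section Reading.
Variable B : finType.
Local Open Scope group_scope.
Implicit Types (l m : letter B) (g h k : free_group B) (u v w : word B).
Implicit Types (G : lgraph B) (e : nat * B * nat) (x y z : nat).

Definition step G x l y : bool :=
  (if l.2 then (y, l.1, x) else (x, l.1, y)) \in edges G.

Fixpoint reads G x w y : Prop :=
  if w is l :: w' then exists z, step G x l z /\ reads G z w' y else x = y.

Lemma wstepP G x s y : wstep G (Some x) s = Some y <->
  s = (if s.2 then (y, elab s.1, x) else (x, elab s.1, y), s.2)
  /\ step G x (elab s.1, s.2) y.
Proof.
case: s => -[[a b] c] t; rewrite /wstep /step /elab /esrc /etgt /=.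
case: t => /=; split.
- by case: ifP => // ein; case: eqP => // <- [<-].
- by case=> -[-> ->] ->; rewrite eqxx.
- by case: ifP => // ein; case: eqP => // <- [<-].
- by case=> -[-> ->] ->; rewrite eqxx.
Qed.

Lemma readsP G x w y : reads G x w y <->
  exists p, walk_end G x p = Some y /\ walk_label p = w.
Proof.
have foldl_None p : foldl (wstep G) None p = None by elim: p.
elim: w x => [|l w IH] x /=.
  split=> [->|[[|s p] [pE //]]]; first by exists [::].
  by case: pE.
split=> [[z [xz /IH[p [pE pw]]]]|[[|s p] [// pE [sl pw]]]].
  exists ((if l.2 then (z, l.1, x) else (x, l.1, z), l.2) :: p); split; last first.
    by rewrite /= pw; case: (l) => b [].
  rewrite /walk_end /= -pE /walk_end; congr (foldl _ _ p).
  by case: l xz => b [] /=; rewrite /step /= => ->; rewrite /esrc /etgt /= eqxx.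
have {}pE : foldl (wstep G) (wstep G (Some x) s) p = Some y := pE.
case xs: (wstep G (Some x) s) pE => [z|]; last by rewrite foldl_None.
move=> pE; exists z; have [_] := (wstepP _ _ _ _).1 xs; rewrite sl => xz.
by split=> //; apply/IH; exists p.
Qed.

Lemma reads_cat G x u v y :
  reads G x (u ++ v) y <-> exists z, reads G x u z /\ reads G z v y.
Proof.
elim: u x => [|l u IH] x /=.
  by split=> [xy|[z [->]//]]; exists x.
split=> [[z [xz /IH[t [zt ty]]]]|[t [[z [xz zt]] ty]]].
  by exists t; split=> //; exists z.
by exists z; split=> //; apply/IH; exists t.
Qed.

Lemma step_linv G x l y : step G x (linv l) y = step G y l x.
Proof. by case: l => b []. Qed.

Lemma reads_winv G x w y : reads G x w y -> reads G y (winv w) x.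
Proof.
elim: w x => [|l w IH] x /=; first by move->.
case=> z [xz /IH yz]; rewrite winv_cons -cats1; apply/reads_cat; exists z; split=> //.
by exists x; rewrite step_linv.
Qed.

Lemma step_lt G x l y : wf_graph G -> step G x l y -> x < nv G /\ y < nv G.
Proof.
move=> /allP wf; rewrite /step.
by case: ifP => _ /wf; rewrite /esrc /etgt /= => /andP[].
Qed.

Lemma reads_lt G x w y : wf_graph G -> x < nv G -> reads G x w y -> y < nv G.
Proof.
move=> wG; elim: w x => [|l w IH] x lx /=; first by move=> <-.
by case=> z [/(step_lt wG)[_ /IH]]; apply.
Qed.

Definition edge_end (s : bool) e := if s then etgt e else esrc e.

Lemma folded_inj G s : folded G -> {in edges G &, forall e e',
  elab e = elab e' -> edge_end s e = edge_end s e' -> e = e'}.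
Proof.
move=> [_ fG] e e' eG e'G eqlab eqend; apply/eqP/negP => /negP ne.
case: (fG _ _ eG e'G ne) => [|[nsrc ntgt]]; first by rewrite eqlab eqxx.
by move: eqend nsrc ntgt; rewrite /edge_end; case: s => /= ->; rewrite eqxx.
Qed.

Lemma step_det G x l y z : folded G -> step G x l y -> step G x l z -> y = z.
Proof.
move=> fG; rewrite /step; case: l => b [] /= xy xz.
  by have [] := folded_inj (s := true) fG xy xz erefl erefl.
by have [] := folded_inj (s := false) fG xy xz erefl erefl.
Qed.

Lemma reads_det G x w y z : folded G -> reads G x w y -> reads G x w z -> y = z.
Proof.
move=> fG; elim: w x => [|l w IH] x /=; first by move=> -> ->.
case=> t [xt ty] [t' [xt' t'z]]; rewrite (step_det fG xt xt') in ty.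
exact: IH ty t'z.
Qed.

Lemma reads_reduce G x w y : folded G -> reads G x w y -> reads G x (reduce w) y.
Proof.
move=> fG; elim: w x => [//|l w IH] x /= [z [xz /IH]].
rewrite -/(reduce w); case: (reduce w) => [|m v] /= zy; first by exists z.
case: zy => t [zt ty]; case: eqP => [ml|_]; last by exists z; split=> //; exists t.
suff -> : x = t by []; apply: (step_det fG (l := linv l) (x := z)); last by rewrite -ml.
by rewrite step_linv.
Qed.

Definition carries G x g y := reads G x (val g) y.

Lemma carries_wordg G x w y : folded G -> reads G x w y -> carries G x (wordg w) y.
Proof. exact: reads_reduce. Qed.

Lemma carriesM G x g y h z : folded G -> carries G x g y -> carries G y h z ->
  carries G x (g * h) z.
Proof. by move=> fG xy yz; apply: reads_reduce => //; apply/reads_cat; exists y. Qed.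

Lemma carriesV G x g y : carries G x g y -> carries G y g^-1 x.
Proof. by rewrite /carries val_inv; apply: reads_winv. Qed.

Lemma carries_loop G x g y k : folded G -> carries G x g y ->
  carries G y k y <-> carries G x (k ^ g^-1) x.
Proof.
move=> fG xy; have yx := carriesV xy; rewrite conjgE invgK.
split=> loop; first by apply: carriesM xy _ => //; apply: carriesM loop _.
have := carriesM fG yx (carriesM fG loop xy).
by rewrite !mulgA mulgVK mulVg mul1g.
Qed.

Lemma carries_eq G x g y g' y' : folded G -> carries G x g y -> carries G x g' y' ->
  y = y' <-> carries G x (g / g') x.
Proof.
move=> fG xy xy'; split=> [yy'|loop].
  by apply: carriesM xy _ => //; rewrite yy'; apply: carriesV.
by have := carriesM fG loop xy'; rewrite mulgVK; apply: reads_det.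
Qed.

Lemma connected_carries G x y : folded G -> connected G -> x < nv G -> y < nv G ->
  exists g, carries G x g y.
Proof.
move=> fG cG lx ly; have [p [_ xy]] := cG x y lx ly.
by exists (wordg (walk_label p)); apply: carries_wordg => //; apply/readsP; exists p.
Qed.

Definition in_link G x l : bool :=
  has (fun e => (elab e == l.1) && (edge_end l.2 e == x)) (edges G).

Lemma in_linkP G x l : in_link G x l <-> exists y, step G x l y.
Proof.
split=> [/hasP[[[a b] c] eG]|[y xy]]; rewrite /elab /edge_end /esrc /etgt /=.
  by case: l => b' [] /= /andP[/eqP<- /eqP<-]; [exists a | exists c].
apply/hasP; exists (if l.2 then (y, l.1, x) else (x, l.1, y)) => //.
by rewrite /elab /edge_end /esrc /etgt; case: l {xy} => b [] /=; rewrite !eqxx.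
Qed.

Lemma in_link_lt G x l : wf_graph G -> in_link G x l -> x < nv G.
Proof. by move=> wG /in_linkP[y] /(step_lt wG)[]. Qed.

Lemma count_in_link G l : wf_graph G -> folded G ->
  count (fun e => elab e == l.1) (edges G) = count (fun x => in_link G x l) (iota 0 (nv G)).
Proof.
move=> /allP wG fG; rewrite -!size_filter -(size_map (edge_end l.2)).
apply: perm_size; apply: uniq_perm; rewrite ?filter_uniq ?iota_uniq //.
  rewrite map_inj_in_uniq ?filter_uniq //; first by case: fG.
  move=> e e'; rewrite !mem_filter => /andP[/eqP le eG] /andP[/eqP le' e'G].
  by apply: (folded_inj fG) => //; rewrite le.
move=> x; rewrite mem_filter mem_iota add0n /=; apply/mapP/andP => [[e]|[/hasP[e eG]]].
  rewrite mem_filter => /andP[le eG] ->; split.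
    by apply/hasP; exists e; rewrite ?le /=.
  by have /andP[] := wG e eG; rewrite /edge_end; case: ifP.
by move=> /andP[le /eqP ex] _; exists e; rewrite ?mem_filter ?le.
Qed.

Lemma count_edge_end G x s : folded G ->
  count (fun e => edge_end s e == x) (edges G) = #|[pred b | in_link G x (b, s)]|.
Proof.
move=> fG; rewrite -size_filter -(size_map (@elab B)) cardE.
apply: perm_size; apply: uniq_perm; rewrite ?enum_uniq //.
  rewrite map_inj_in_uniq ?filter_uniq //; first by case: fG.
  move=> e e'; rewrite !mem_filter => /andP[/eqP se eG] /andP[/eqP se' e'G].
  by move=> eqlab; apply: (folded_inj (s := s) fG) => //; rewrite se.
move=> b; rewrite mem_enum inE; apply/mapP/hasP => [[e]|[e eG /= /andP[/eqP <- se]]].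
  by rewrite mem_filter => /andP[se eG] ->; exists e; rewrite //= eqxx.
by exists e; rewrite ?mem_filter ?se.
Qed.

Lemma degree_card_link G x : folded G -> degree G x = #|[pred l | in_link G x l]|.
Proof.
move=> fG; rewrite /degree (count_edge_end x false fG) (count_edge_end x true fG).
rewrite -!sum1_card; pose F b s := if in_link G x (b, s) then 1%N else 0.
rewrite [RHS]big_mkcond (eq_bigr (fun l => F l.1 l.2)) => [|[b s] _ //].
rewrite -(pair_bigA _ F) exchange_big big_bool addnC /=.
by rewrite !(big_mkcond (fun b => b \in _)).
Qed.

Lemma degree_gt1P G x : folded G ->
  reflect (exists l m, [/\ l != m, in_link G x l & in_link G x m]) (1 < degree G x).
Proof.
move=> fG; rewrite degree_card_link //.
apply: (iffP card_gt1P) => [[l [m []]]|[l [m [nlm xl xm]]]].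
  by rewrite !inE => xl xm nlm; exists l, m.
by exists l, m; rewrite !inE.
Qed.

Definition core_graph G :=
  [/\ wf_graph G, folded G, connected G & forall x, x < nv G -> 1 < degree G x].

Lemma long_reading G x l n : core_graph G -> in_link G x l ->
  exists w y, [/\ reduced (l :: w), size w = n & reads G x (l :: w) y].
Proof.
move=> [wG fG _ dG] xl; have lx := in_link_lt wG xl.
elim: n => [|n [w [y [rw sw xy]]]].
  have [y xy] := (in_linkP _ _ _).1 xl.
  by exists [::], y; split=> //; [apply: reduced1 | exists y].
have ly := reads_lt wG lx xy.
have [k [m [nkm yk ym]]] := degree_gt1P _ fG (dG y ly).
have [q nq yq] : exists2 q, q != linv (last l w) & in_link G y q.
  have [e|nk] := eqVneq k (linv (last l w)); last by exists k.
  by exists m; rewrite // -e eq_sym.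
have [z yz] := (in_linkP _ _ _).1 yq; exists (rcons w q), z; split.
- by rewrite -rcons_cons lastI reduced_rcons2 nq -lastI.
- by rewrite size_rcons sw.
by rewrite -rcons_cons -cats1; apply/reads_cat; exists y; split=> //; exists z.
Qed.

(* The core is finite, so a long reduced reading closes up by one of finitely many
   elements, without changing the first letter. *)
Lemma direction_in_link G x l : core_graph G -> in_link G x l ->
  direction (fun k => carries G x k x) l.
Proof.
move=> cG xl; have [wG fG conG _] := cG; have lx := in_link_lt wG xl.
have /choice[c yc] (y : 'I_(nv G)) : exists h, carries G y h x by exact: connected_carries.
move=> N; have [M longM] := almost_all_forall (fun y : 'I_(nv G) =>
  almost_all_and (proper_mulr (c y) N) (tame_mulr (c y) (tame_starts [:: l]))).
have [w [y [rw sw xy]]] := long_reading M cG xl.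
have ly := reads_lt wG lx xy.
have wE : val (wordg (l :: w)) = l :: w by rewrite val_wordg_reduced.
have [|lN sl] := longM (wordg (l :: w)) _ (Ordinal ly); first by rewrite /len wE /= sw.
exists (wordg (l :: w) * c (Ordinal ly)) => //; split.
  by apply: (carriesM fG _ (yc (Ordinal ly))); rewrite /carries wE.
by rewrite sl (starts1E _ wE) eqxx.
Qed.

End Reading.

(** * Finitely generated subgroups *)

Section Generated.
Variable B : finType.
Local Open Scope group_scope.
Implicit Types (g h k : free_group B) (u v w : word B) (gens : seq (word B)).

Definition generated gens g : Prop := in_sub gens (val g).

Definition signed_gen gens (x : nat * bool) : word B :=
  if x.2 then winv (nth [::] gens x.1) else nth [::] gens x.1.

Lemma in_sub_wordg gens w : in_sub gens w <-> generated gens (wordg w).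
Proof. by rewrite /generated /in_sub val_wordg reduceK. Qed.

Lemma generatedP gens g : generated gens g <-> exists2 s, all (fun x => x.1 < size gens) s &
  g = wordg (flatten (map (signed_gen gens) s)).
Proof.
split=> [[s [sg sE]]|[s sg ->]]; exists s => //; last by rewrite val_wordg reduceK.
by apply: val_inj; rewrite val_wordg sE reduce_id // reduced_val.
Qed.

Lemma generated_ind gens (P : free_group B -> Prop) : P 1 ->
  (forall x g, x.1 < size gens -> generated gens g -> P g ->
     P (wordg (signed_gen gens x) * g)) ->
  forall g, generated gens g -> P g.
Proof.
move=> P1 PM _ /generatedP[s + ->]; elim: s => [//|x s IH] /= /andP[lx sg].
by rewrite wordg_cat; apply: PM (IH sg) => //; apply/generatedP; exists s.
Qed.

Lemma generated1 gens : generated gens 1.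
Proof. by apply/generatedP; exists [::]. Qed.

Lemma generated_mulgen gens x g : x.1 < size gens -> generated gens g ->
  generated gens (wordg (signed_gen gens x) * g).
Proof.
move=> lx /generatedP[s sg ->]; apply/generatedP; exists (x :: s); rewrite /= ?lx //.
by rewrite wordg_cat.
Qed.

Lemma generated_gen gens x : x.1 < size gens -> generated gens (wordg (signed_gen gens x)).
Proof. by move=> lx; rewrite -[wordg _]mulg1; apply: generated_mulgen (generated1 _). Qed.

Lemma subgroup_generated gens : subgroup (generated gens).
Proof.
have genM g h : generated gens g -> generated gens h -> generated gens (g * h).
  move=> Kg Kh; elim/generated_ind: Kg => [|x k lx _ IH]; first by rewrite mul1g.
  by rewrite -mulgA; apply: generated_mulgen.
split=> //; first exact: generated1.
move=> g; elim/generated_ind => [|x k lx _ IH]; first by rewrite invg1; apply: generated1.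
rewrite invgM; apply: genM => //.
have := @generated_gen gens (x.1, ~~ x.2) lx.
by rewrite -wordg_winv /signed_gen /=; case: x.2; rewrite //= winvK.
Qed.

End Generated.

(** * Core graphs as sets of cosets *)

Section CosetLabelling.
Variable B : finType.
Local Open Scope group_scope.
Implicit Types (l m : letter B) (g h k : free_group B) (u v w : word B).
Implicit Types (G : lgraph B) (K : free_group B -> Prop) (x y z : nat).

(* [at_coset x g] means that the vertex [x] of the core graph [G] of [K] is the coset [K g]. *)
Record coset_labelling K G (at_coset : nat -> free_group B -> Prop) : Prop := CosetLabelling {
  coset_lt : forall x g, at_coset x g -> x < nv G;
  coset_exists : forall x, x < nv G -> exists g, at_coset x g;
  coset_eq : forall x x' g g', at_coset x g -> at_coset x' g' -> x = x' <-> K (g / g');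
  coset_link : forall x g l, at_coset x g -> in_link G x l <-> direction (K :^ g) l;
  coset_two_directions : forall g, two_directions (K :^ g) <-> exists x, at_coset x g
}.

Section BasedGraph.
Variables (K : free_group B -> Prop) (G : lgraph B) (x0 : nat) (g0 : free_group B).
Hypotheses (cG : core_graph G) (lx0 : x0 < nv G).
Hypothesis loops : forall k, carries G x0 k x0 <-> K (k ^ g0).

Definition based_coset x g := carries G x0 (g0 * g) x.

Let fG : folded G. Proof. by case: cG. Qed.

Lemma based_coset_lt x g : based_coset x g -> x < nv G.
Proof. by have [wG _ _ _] := cG; apply: reads_lt. Qed.

Lemma based_coset_loop x g k : based_coset x g -> carries G x k x <-> (K :^ g) k.
Proof.
move=> xg; rewrite (carries_loop _ fG xg) loops /conjugate -conjgM.
by rewrite invgM mulgVK.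
Qed.

Lemma based_coset_eq x x' g g' : based_coset x g -> based_coset x' g' ->
  x = x' <-> K (g / g').
Proof.
move=> xg xg'; rewrite (carries_eq fG xg xg') loops conjgE invgM !mulgA mulVg mul1g.
by rewrite mulgVK.
Qed.

Lemma based_coset_link x g l : based_coset x g -> in_link G x l <-> direction (K :^ g) l.
Proof.
move=> xg; have -> : K :^ g = (fun k => carries G x k x).
  by apply: funext => k; apply: propext; rewrite (based_coset_loop _ xg).
split; first exact: direction_in_link.
case/(_ 0)=> k _ [+ /prefixP[w kE]]; rewrite /carries kE => -[y [xy _]].
by apply/in_linkP; exists y.
Qed.

Lemma based_coset_two_directions g : two_directions (K :^ g) <-> exists x, based_coset x g.
Proof.
split=> [dirKg|[x xg]]; last first.
  have [_ _ _ dG] := cG.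
  have [l [m [nlm xl xm]]] := degree_gt1P _ fG (dG x (based_coset_lt xg)).
  by exists l, m; split=> //; apply/(based_coset_link _ xg).
have KE : K :^ g = (fun k => carries G x0 k x0) :^ (g0 * g).
  apply: funext => k; apply: propext; rewrite /conjugate loops -conjgM.
  by rewrite invgM mulgVK.
rewrite KE in dirKg; have [l /(_ 0)[k _ [+ /prefixP[w kE]]]] := two_directions_next dirKg.
by rewrite /carries kE -cats1 -catA => /reads_cat[x [xg _]]; exists x.
Qed.

Lemma coset_labelling_based : coset_labelling K G based_coset.
Proof.
split.
- exact: based_coset_lt.
- have [_ _ conG _] := cG; move=> x lx; have [h xh] := connected_carries fG conG lx0 lx.
  by exists (g0^-1 * h); rewrite /based_coset mulVKg.
- exact: based_coset_eq.
- exact: based_coset_link.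
exact: based_coset_two_directions.
Qed.

End BasedGraph.

Lemma coset_labelling_trivial K G : (forall k, K k -> k = 1) -> nv G = 0 ->
  coset_labelling K G (fun _ _ => False).
Proof.
move=> K1 nvG0; split=> //; first by rewrite nvG0.
move=> g; split=> [[l [_ [_ /(_ 1%N)[k lk [/K1/eqP + _]] _]]]|[]//].
by rewrite conjg_eq1 => /eqP k1; rewrite k1 in lk.
Qed.

Lemma carries_closed_walk G x g : folded G ->
  carries G x g x <-> exists p, walk_end G x p = Some x /\ reduce (walk_label p) = val g.
Proof.
move=> fG; split=> [/readsP[p [pE pw]]|[p [pE pw]]].
  by exists p; rewrite pw reduce_id // reduced_val.
by rewrite /carries -pw; apply: reads_reduce => //; apply/readsP; exists p.
Qed.

Lemma representsP gens G : folded G -> represents G gens <->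
  (nv G = 0 /\ forall k, generated gens k -> k = 1) \/
  (exists x g, x < nv G /\ forall k, carries G x k x <-> generated gens (k ^ g)).
Proof.
move=> fG; have conjE w (u : word B) :
    in_sub gens (reduce (winv u ++ w ++ u)) <-> generated gens (wordg w ^ wordg u).
  by rewrite in_sub_wordg -val_wordg val_wordgK !wordg_cat wordg_winv conjgE.
have trivE : (forall w, in_sub gens w -> reduce w = [::]) <->
    (forall k, generated gens k -> k = 1).
  split=> triv k; last by rewrite in_sub_wordg => /triv/(congr1 val).
  by move/triv => k1; apply: val_inj; rewrite -(reduce_id (reduced_val k)).
split=> -[[nvG0 /trivE triv]|]; [by left | | by left |] => -[x [g [lx loops]]]; right.
  exists x, (wordg g); split=> // k; rewrite carries_closed_walk //.
  by rewrite (loops _ (reduced_val k)) conjE val_wordgK.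
exists x, (val g); split=> // w rw; rewrite conjE val_wordgK -loops carries_closed_walk //.
by rewrite val_wordg_reduced.
Qed.

Lemma coset_labelling_core gens G : core_of gens G ->
  exists at_coset, coset_labelling (generated gens) G at_coset.
Proof.
move=> [wG fG cG dG /(representsP _ fG)[[nvG0 triv]|[x [g [lx loops]]]]].
  by exists (fun _ _ => False); apply: coset_labelling_trivial.
by exists (based_coset G x g); apply: coset_labelling_based.
Qed.

End CosetLabelling.

(** * Existence of core graphs *)

Section CosetGraph.
Variable B : finType.
Local Open Scope group_scope.
Implicit Types (l m : letter B) (g h k : free_group B) (w : word B) (b : B).
Implicit Types (G : lgraph B) (x y z i j : nat).

Lemma folded_step_det G : uniq (edges G) ->
  (forall x l y z, step G x l y -> step G x l z -> y = z) -> folded G.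
Proof.
move=> uG det; split=> // -[[x b] y] [[x' b'] y'] xy xy' ne.
rewrite /elab /esrc /etgt /=; have [eb|nb] := eqVneq b b'; last by left.
rewrite -eb in xy' ne; right; split; apply: contraNneq ne => exy.
  by rewrite -exy in xy' *; rewrite (det x (b, false) y y').
by rewrite -exy in xy' *; rewrite (det y (b, true) x x').
Qed.

Variables (K : free_group B -> Prop) (L : seq (free_group B)).
Let coset i := nth 1 L i.
Hypothesis sK : subgroup K.
Hypothesis L_two : forall i, i < size L -> two_directions (K :^ coset i).
Hypothesis L_inj : forall i j, i < size L -> j < size L -> K (coset i / coset j) -> i = j.
Hypothesis L_cover : forall g, two_directions (K :^ g) ->
  exists2 i, i < size L & K (g / coset i).

Let K1 : K 1. Proof. by case: sK. Qed.
Let KM g h : K g -> K h -> K (g * h). Proof. by case: sK => _ + _; apply. Qed.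
Let KV g : K g -> K g^-1. Proof. by case: sK => _ _; apply. Qed.

Let K_trans g h k : K (g / h) -> K (h / k) -> K (g / k).
Proof. by move=> Kgh /(KM Kgh); rewrite divgKA. Qed.

Let conjugate_coset g h : K (g / h) -> K :^ g = K :^ h.
Proof. by move=> Kgh; rewrite -(mulgVK h g) conjugate_mulr_mem. Qed.

Definition coset_graph : lgraph B := LGraph (size L)
  [seq (nat_of_ord t.1.1, t.1.2, nat_of_ord t.2) |
     t : 'I_(size L) * B * 'I_(size L) <- enum {: 'I_(size L) * B * 'I_(size L)} &
     `[< K (coset t.1.1 * letterg (t.1.2, false) / coset t.2) >]].

Lemma coset_edge i b j : (i, b, j) \in edges coset_graph <->
  [/\ i < size L, j < size L & K (coset i * letterg (b, false) / coset j)].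
Proof.
split; last first.
  case=> li lj Kij; apply/mapP; exists (Ordinal li, b, Ordinal lj) => //.
  by rewrite mem_filter mem_enum inE andbT; apply/asboolP.
case/mapP=> -[[i' b'] j']; rewrite mem_filter => /andP[/asboolP /= Kij _] [-> -> ->].
by split.
Qed.

Lemma coset_step i l j : step coset_graph i l j <->
  [/\ i < size L, j < size L & K (coset i * letterg l / coset j)].
Proof.
rewrite /step; case: l => b [] /=; rewrite coset_edge //.
have -> : coset i * letterg (b, true) / coset j =
    (coset j * letterg (b, false) / coset i)^-1.
  by rewrite invgF invgM -letterg_linv mulgA.
by split=> -[li lj /KV]; rewrite ?invgK; split.
Qed.

Lemma coset_step_det i l j j' :
  step coset_graph i l j -> step coset_graph i l j' -> j = j'.
Proof.
move=> /coset_step[li lj Kij] /coset_step[_ lj' Kij']; apply: L_inj => //.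
by apply: K_trans Kij'; move/KV: Kij; rewrite invgF.
Qed.

Lemma coset_reads_mem i w j : i < size L -> reads coset_graph i w j ->
  j < size L /\ K (coset i * wordg w / coset j).
Proof.
elim: w i => [|l w IH] i li /=; first by move=> <-; rewrite wordg_nil mulg1 mulgV.
case=> z [/coset_step[_ lz Kz] /(IH _ lz)[lj Kj]]; split=> //.
by have := KM Kz Kj; rewrite wordg_cons !mulgA mulgVK.
Qed.

Lemma coset_reads_two_directions i w j : i < size L -> j < size L ->
  (forall n, two_directions (K :^ (coset i * wordg (take n w)))) ->
  K (coset i * wordg w / coset j) -> reads coset_graph i w j.
Proof.
elim: w i => [|l w IH] i li lj core /=.
  by rewrite wordg_nil mulg1 => /L_inj->.
have [|z lz Kz] := @L_cover (coset i * letterg l).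
  by have := core 1%N; rewrite /= take0.
rewrite wordg_cons mulgA => Kj; exists z; split; first exact/coset_step.
apply: IH => // [n|].
  rewrite (_ : K :^ _ = K :^ (coset i * wordg (take n.+1 (l :: w)))); first exact: core.
  apply: conjugate_coset; rewrite /= wordg_cons mulgA mulgKA.
  by move/KV: Kz; rewrite invgF.
by move/KV: Kz => /KM/(_ Kj); rewrite invgF -(mulgA (coset i * _)) divgKA mulgA.
Qed.

Lemma coset_carries i g j : i < size L -> j < size L ->
  carries coset_graph i g j <-> K (coset i * g / coset j).
Proof.
move=> li lj; split=> [/(coset_reads_mem li)[_]|Kij]; first by rewrite val_wordgK.
apply: coset_reads_two_directions => //; last by rewrite val_wordgK.
move=> n; rewrite -conjugateM; apply: (@two_directions_convex _ _ _ (drop n (val g))).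
- by rewrite cat_take_drop reduced_val.
- exact: L_two.
by rewrite cat_take_drop val_wordgK conjugateM (conjugate_coset Kij); apply: L_two.
Qed.

Lemma core_coset_graph : core_graph coset_graph.
Proof.
have wG : wf_graph coset_graph.
  by apply/allP => -[[i b] j]; rewrite coset_edge /esrc /etgt /= => -[-> ->].
have fG : folded coset_graph.
  apply: folded_step_det coset_step_det; rewrite map_inj_in_uniq.
    exact/filter_uniq/enum_uniq.
  by move=> [[i b] j] [[i' b'] j'] _ _ /= [/val_inj-> -> /val_inj->].
split=> // [i j li lj|i li].
  have /readsP[p [pE _]] : carries coset_graph i ((coset i)^-1 * coset j) j.
    by apply/coset_carries; rewrite // mulVKg mulgV.
  by exists p; split=> //; apply/allP.
have [l [m [nlm Kl Km]]] := L_two li; apply/(degree_gt1P _ fG); exists l, m.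
have in_link_direction q : direction (K :^ coset i) q -> in_link coset_graph i q.
  case/(_ 0)=> k _ [+ /prefixP[w kE]]; rewrite /conjugate conjgE invgK mulgA => Kk.
  have : carries coset_graph i k i by apply/coset_carries.
  by rewrite /carries kE => -[y [iy _]]; apply/in_linkP; exists y.
by split=> //; apply: in_link_direction.
Qed.

End CosetGraph.

Section CoreExists.
Variable B : finType.
Local Open Scope group_scope.
Implicit Types (l m : letter B) (g h k u : free_group B) (w : word B).

Lemma take_reduce w n : exists i, wordg (take n (reduce w)) = wordg (take i w).
Proof.
elim: w n => [|l w IH] n; first by exists 0.
rewrite /= -/(reduce w).
have take_cons r : (forall n, exists i, wordg (take n r) = wordg (take i w)) ->
    exists i, wordg (take n (l :: r)) = wordg (take i (l :: w)).
  case: n => [|n] take_r; first by exists 0.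
  by have [i iE] := take_r n; exists i.+1; rewrite /= !wordg_cons iE.
case wE: (reduce w) => [|m r] /=; rewrite wE in IH; first exact: take_cons.
case: eqP => [ml|_]; last exact: take_cons.
have [i iE] := IH n.+1; exists i.+1; rewrite /= wordg_cons -iE /= wordg_cons ml.
by rewrite letterg_linv mulVKg.
Qed.

Variable gens : seq (word B).
Let K := generated gens.

Let K1 : K 1. Proof. exact: generated1. Qed.
Let KM g h : K g -> K h -> K (g * h).
Proof. by have [_ + _] := subgroup_generated gens; apply. Qed.
Let KV g : K g -> K g^-1. Proof. by have [_ _] := subgroup_generated gens; apply. Qed.

Definition gen_prefixes : seq (free_group B) :=
  1 :: [seq wordg (take i w) | w <- gens, i <- iota 0 (size w).+1].

Lemma mem_gen_prefixes w i : w \in gens -> wordg (take i w) \in gen_prefixes.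
Proof.
move=> wg; rewrite inE; apply/orP; right; apply/allpairsPdep.
exists w, (minn i (size w)); split=> //; first by rewrite mem_iota ltnS geq_minr.
have [le|lt] := leqP i (size w); first by [].
by rewrite take_size take_oversize // ltnW.
Qed.

Lemma signed_gen_prefix x i : x.1 < size gens ->
  exists2 u, u \in gen_prefixes & K (wordg (take i (signed_gen gens x)) / u).
Proof.
case: x => n b /= ln; have wg : nth [::] gens n \in gens by apply: mem_nth.
have := generated_gen (x := (n, b)) ln; rewrite /signed_gen /=.
move: (nth _ _ _) wg => w wg; case: b => [|_]; last first.
  by exists (wordg (take i w)); rewrite ?mem_gen_prefixes // mulgV.
move=> Kw; exists (wordg (take (size w - i) w)); first exact: mem_gen_prefixes.
have -> : wordg (take i (winv w)) = (wordg (drop (size w - i) w))^-1.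
  by rewrite -wordg_winv /winv take_rev size_map map_drop.
by rewrite -invgM -wordg_cat cat_take_drop -wordg_winv.
Qed.

Lemma flatten_gen_prefix s i : all (fun x => x.1 < size gens) s ->
  exists2 u, u \in gen_prefixes &
    K (wordg (take i (flatten (map (signed_gen gens) s))) / u).
Proof.
elim: s i => [|x s IH] i /=; first by exists 1; rewrite ?mem_head // mulgV.
move=> /andP[lx sg]; rewrite take_cat; case: ltnP => _; first exact: signed_gen_prefix.
have [u uP Ku] := IH (i - size (signed_gen gens x)) sg; exists u => //.
by rewrite wordg_cat -mulgA; apply: KM => //; apply: generated_gen.
Qed.

Lemma generated_prefix k i : K k ->
  exists2 u, u \in gen_prefixes & K (wordg (take i (val k)) / u).
Proof.
move=> /generatedP[s sg ->].
have [j ->] := take_reduce (flatten (map (signed_gen gens) s)) i.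
exact: flatten_gen_prefix.
Qed.

Lemma two_directions_gen_prefix g : two_directions (K :^ g) ->
  exists2 u, u \in gen_prefixes & K (g / u).
Proof.
case/two_directions_next=> l /(_ 0)[k _ [Kk /prefixP[w kE]]].
have [u uP Ku] := generated_prefix (size (val g)) Kk; exists u => //.
by move: Ku; rewrite kE cat_rcons take_size_cat // val_wordgK.
Qed.

Lemma exists_core_cosets : exists L : seq (free_group B), let coset i := nth 1 L i in
  [/\ forall i, i < size L -> two_directions (K :^ coset i),
      forall i j, i < size L -> j < size L -> K (coset i / coset j) -> i = j &
      forall g, two_directions (K :^ g) -> exists2 i, i < size L & K (g / coset i)].
Proof.
have [|L [Lsub Lpw Lcov]] := @exists_transversal _ (fun g h => K (g / h))
    [seq u <- gen_prefixes | `[< two_directions (K :^ u) >]].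
  by move=> g; rewrite mulgV.
exists L => coset; split.
- by move=> i /(mem_nth 1)/Lsub; rewrite mem_filter => /andP[/asboolP].
- move=> i j li lj Kij; move/(pairwiseP 1): Lpw => Lpw.
  case: (ltngtP i j) => // lij; first by have /asboolP[] := Lpw i j li lj lij.
  by have /asboolP[] := Lpw j i lj li lij; rewrite -invgF; apply: KV.
move=> g dirKg; have [u uP Ku] := two_directions_gen_prefix dirKg.
have [|v vL Kv] := Lcov u.
  rewrite mem_filter uP andbT; apply/asboolP.
  by move: dirKg; rewrite -(mulgVK u g) conjugate_mulr_mem //; apply: subgroup_generated.
exists (index v L); first by rewrite index_mem.
by rewrite /coset nth_index // -(divgKA u); apply: KM.
Qed.

Lemma core_exists : exists G, core_of gens G.
Proof.
have sK := subgroup_generated gens.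
have [L [L_two L_inj L_cover]] := exists_core_cosets.
have cG := core_coset_graph sK L_two L_inj L_cover; have [wG fG conG dG] := cG.
exists (coset_graph K L); split=> //; apply/representsP => //.
have [L0|nzL] := posnP (size L); [left | right]; last first.
  exists 0, (nth 1 L 0)^-1; split=> // k.
  by rewrite (coset_carries sK L_two L_inj L_cover) // conjgE invgK mulgA.
split=> // k Kk; apply: contrapT => /eqP k1.
by have [g /L_cover[i]] := exists_two_directions sK Kk k1; rewrite L0.
Qed.

End CoreExists.

Lemma sigma_exists (B : finType) (Hs : seq (seq (word B))) : exists Gs, sigma_seq Hs Gs.
Proof.
have /choice[f fP] := @core_exists B; exists (map f Hs); split; first by rewrite size_map.
by move=> i li; rewrite (nth_map [::]).
Qed.

(** * Sequences of core graphs *)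

Section CoreSequences.
Variable B : finType.
Local Open Scope group_scope.
Implicit Types (l m : letter B) (g h t : free_group B) (j x : nat).
Implicit Types (Hs : seq (seq (word B))) (Gs : seq (lgraph B)) (Q : pred (letter B)).

Definition subgroup_at Hs j := generated (nth [::] Hs j).
Definition graph_at Gs j := nth (G0 B) Gs j.

Definition vertices Gs : seq (nat * nat) :=
  [seq (j, x) | j <- iota 0 (size Gs), x <- iota 0 (nv (graph_at Gs j))].

Lemma mem_vertices Gs j x :
  ((j, x) \in vertices Gs) = (j < size Gs) && (x < nv (graph_at Gs j)).
Proof.
apply/allpairsPdep/andP => [[j' [x' [+ + [-> ->]]]]|[lj lx]].
  by rewrite !mem_iota !add0n.
by exists j, x; rewrite !mem_iota !add0n.
Qed.

Lemma uniq_vertices Gs : uniq (vertices Gs).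
Proof.
apply: allpairs_uniq_dep => [|j _|]; rewrite ?iota_uniq //.
by move=> [j x] [j' x'] _ _ /= [-> ->].
Qed.

Definition link Gs (v : nat * nat) l := in_link (graph_at Gs v.1) v.2 l.

Definition link_crosses Gs Q v :=
  [exists l, Q l && link Gs v l] && [exists l, ~~ Q l && link Gs v l].

Definition capacity Q Gs := count (link_crosses Gs Q) (vertices Gs).

Lemma link_crossesP Gs Q v :
  reflect (exists l m, [/\ Q l, ~~ Q m, link Gs v l & link Gs v m]) (link_crosses Gs Q v).
Proof.
apply: (iffP andP) => [[/existsP[l /andP[Ql vl]] /existsP[m /andP[Qm vm]]]|].
  by exists l, m.
by case=> l [m [Ql Qm vl vm]]; split; apply/existsP; [exists l | exists m]; apply/andP.
Qed.

Lemma capacity_predC Q Gs : capacity (predC Q) Gs = capacity Q Gs.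
Proof.
apply: eq_count => v; rewrite /link_crosses andbC; congr (_ && _).
by apply: eq_existsb => l /=; rewrite negbK.
Qed.

Lemma nlab_count_link Hs Gs l : sigma_seq Hs Gs ->
  nlab l.1 Gs = count (fun v => link Gs v l) (vertices Gs).
Proof.
case=> sz core; rewrite /nlab /vertices count_flatten -map_comp; congr sumn.
rewrite -[in LHS](mkseq_nth (G0 B) Gs) /mkseq -map_comp.
apply/eq_in_map => j; rewrite mem_iota add0n sz /= => lj; have [wG fG _ _ _] := core j lj.
by rewrite count_in_link // count_map.
Qed.

Lemma total_edges_sum_nlab Gs : total_edges Gs = (\sum_b nlab b Gs)%N.
Proof.
rewrite /total_edges /nlab; under eq_bigr do rewrite sumnE big_map.
rewrite sumnE big_map exchange_big; apply: eq_bigr => G _.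
elim: (edges G) => [|e s IH] /=; first by rewrite big1.
rewrite big_split /= -IH (bigD1 (elab e)) //= eqxx big1 ?addn0 // => b.
by rewrite eq_sym => /negbTE->.
Qed.

Definition sequence_labelling Hs Gs (at_coset : nat -> nat -> free_group B -> Prop) :=
  size Gs = size Hs /\
  forall j, j < size Hs -> coset_labelling (subgroup_at Hs j) (graph_at Gs j) (at_coset j).

Lemma sequence_labelling_exists Hs Gs : sigma_seq Hs Gs ->
  exists at_coset, sequence_labelling Hs Gs at_coset.
Proof.
case=> sz core; suff /choice[f fP] j : exists at_coset : nat -> free_group B -> Prop,
  j < size Hs -> coset_labelling (subgroup_at Hs j) (graph_at Gs j) at_coset by exists f.
have [lj|] := ltnP j (size Hs); last by exists (fun _ _ => False).
by have [at_coset lab] := coset_labelling_core (core j lj); exists at_coset.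
Qed.

Section Labelled.
Variables (Hs : seq (seq (word B))) (Gs : seq (lgraph B)).
Variable at_coset : nat -> nat -> free_group B -> Prop.
Hypothesis lab : sequence_labelling Hs Gs at_coset.

Let labelling j : j < size Hs ->
  coset_labelling (subgroup_at Hs j) (graph_at Gs j) (at_coset j).
Proof. by case: lab => _; apply. Qed.

Lemma vertex_index v : v \in vertices Gs -> v.1 < size Hs.
Proof. by case: lab v => <- _ [j x]; rewrite mem_vertices => /andP[]. Qed.

Lemma at_coset_vertex j x g : j < size Hs -> at_coset j x g -> (j, x) \in vertices Gs.
Proof. by move=> lj xg; rewrite mem_vertices (coset_lt (labelling lj) xg) lab.1 lj. Qed.

Lemma vertex_coset v : v \in vertices Gs -> exists g, at_coset v.1 v.2 g.
Proof.
move=> vG; apply: (coset_exists (labelling (vertex_index vG))).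
by move: vG; case: v => j x; rewrite mem_vertices => /andP[].
Qed.

Lemma vertex_link v g l : v.1 < size Hs -> at_coset v.1 v.2 g ->
  link Gs v l <-> direction (subgroup_at Hs v.1 :^ g) l.
Proof. by move=> lj vg; apply: (coset_link (labelling lj) l vg). Qed.

Lemma vertex_two_letters v : v \in vertices Gs ->
  exists l m, [/\ l != m, link Gs v l & link Gs v m].
Proof.
move=> vG; have lj := vertex_index vG; have [g vg] := vertex_coset vG.
have [l [m [nlm Kl Km]]] : two_directions (subgroup_at Hs v.1 :^ g).
  by apply/(coset_two_directions (labelling lj)); exists v.2.
by exists l, m; split=> //; apply/(vertex_link _ lj vg).
Qed.

Lemma crosses_vertex j g Q : j < size Hs ->
  crosses (subgroup_at Hs j :^ g) (cone Q) <->
  exists2 x, at_coset j x g & link_crosses Gs Q (j, x).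
Proof.
move=> lj; rewrite crosses_cone; split=> [[l [m [Ql Qm Kl Km]]]|[x xg]]; last first.
  case/link_crossesP=> l [m [Ql Qm]]; rewrite !(vertex_link (v := (j, x)) _ lj xg).
  by exists l, m.
have [|x xg] := (coset_two_directions (labelling lj) g).1.
  by exists l, m; split=> //; apply: contraNneq Qm => <-.
exists x => //; apply/link_crossesP; exists l, m.
by split=> //; apply/(vertex_link (v := (j, x)) _ lj xg).
Qed.

Lemma nlab_capacity l : sigma_seq Hs Gs -> nlab l.1 Gs = capacity (pred1 l) Gs.
Proof.
move=> sG; rewrite (nlab_count_link l sG); apply: eq_in_count => v vG.
have [m [m' [nmm' vm vm']]] := vertex_two_letters vG.
apply/idP/link_crossesP => [vl|[l' [? [/eqP-> //]]]].
have [ml|nml] := eqVneq m l; last by exists l, m; rewrite /= eqxx.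
by exists l, m'; rewrite /= eqxx -ml eq_sym.
Qed.

End Labelled.

Definition uniquely_crossed Hs (X : pred (free_group B)) := forall j j' g g',
  j < size Hs -> j' < size Hs ->
  crosses (subgroup_at Hs j :^ g) X -> crosses (subgroup_at Hs j' :^ g') X ->
  j = j' /\ subgroup_at Hs j (g / g').

Lemma uniquely_crossed_cone Hs Gs at_coset Q : sequence_labelling Hs Gs at_coset ->
  capacity Q Gs <= 1 -> uniquely_crossed Hs (cone Q).
Proof.
move=> lab /(count_le1_eq (uniq_vertices Gs)) unique j j' g g' lj lj'.
case/(crosses_vertex lab _ _ lj) => x xg vQ.
case/(crosses_vertex lab _ _ lj') => x' xg' v'Q.
have [ej ex] := unique _ _ (at_coset_vertex lab lj xg) (at_coset_vertex lab lj' xg') vQ v'Q.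
by subst j' x'; split=> //; apply/(coset_eq (lab.2 j lj) xg xg').
Qed.

Section Transport.
Variables f f' : endomorphism B.
Hypotheses (fK : cancel f f') (f'K : cancel f' f).
Variables Hs1 Hs2 : seq (seq (word B)).
Hypothesis size_Hs : size Hs2 = size Hs1.
Hypothesis subgroupE : forall j, subgroup_at Hs2 j = subgroup_at Hs1 j \o f'.

Lemma crosses_transport j g (X : pred (free_group B)) :
  crosses (subgroup_at Hs2 j :^ g) X <-> crosses (subgroup_at Hs1 j :^ f' g) (X \o f).
Proof. by rewrite subgroupE conjugate_morphism; apply: crosses_morphism. Qed.

Lemma uniquely_crossed_transport X : uniquely_crossed Hs2 X -> uniquely_crossed Hs1 (X \o f).
Proof.
move=> uX j j' g g' lj lj'; rewrite -{1}(fK g) -{1}(fK g') -!crosses_transport => jX j'X.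
rewrite -size_Hs in lj lj'; have [ej] := uX _ _ _ _ lj lj' jX j'X.
by rewrite subgroupE /= -gmulfF fK.
Qed.

Lemma capacity_transport Gs1 Gs2 at_coset1 at_coset2 Q1 Q2 t :
  sequence_labelling Hs1 Gs1 at_coset1 -> sequence_labelling Hs2 Gs2 at_coset2 ->
  (forall g, cone Q2 (t^-1 * f g) = cone Q1 g) -> capacity Q2 Gs2 <= capacity Q1 Gs1.
Proof.
move=> lab1 lab2 coneE; rewrite /capacity -!size_filter.
pose R (v2 v1 : nat * nat) := v2.1 = v1.1 /\
  exists2 g, at_coset2 v2.1 v2.2 g & at_coset1 v1.1 v1.2 (f' (g / t)).
apply: (@leq_size_rel _ _ _ _ R); first by rewrite filter_uniq // uniq_vertices.
  move=> [j x]; rewrite mem_filter => /andP[xQ jx].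
  have lj2 := vertex_index lab2 jx; have lj1 : j < size Hs1 by rewrite -size_Hs.
  have [g xg] := vertex_coset lab2 jx.
  have : crosses (subgroup_at Hs2 j :^ g) (cone Q2).
    by apply/(crosses_vertex lab2) => //; exists x.
  rewrite -(crosses_conjugate _ t^-1 (tame_cone Q2)) conjugateM crosses_transport.
  have -> : (fun h => cone Q2 (t^-1 * h)) \o f = cone Q1 by apply: funext.
  case/(crosses_vertex lab1 _ _ lj1)=> x1 x1g x1Q.
  exists (j, x1); last by split=> //; exists g.
  by rewrite mem_filter x1Q (at_coset_vertex lab1 lj1 x1g).
move=> [j x] [j' x'] [j1 x1]; rewrite !mem_filter => /andP[_ /(vertex_index lab2) /= lj2] _.
move=> [/= ej [g xg x1g]] [/= ej' [g' xg' x1g']]; subst j1 j'; congr (_, _).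
apply/(coset_eq (lab2.2 j lj2) xg xg'); rewrite size_Hs in lj2.
have /(coset_eq (lab1.2 j lj2) x1g x1g') := erefl x1.
by rewrite subgroupE /= -gmulfF mulgKA.
Qed.

End Transport.

End CoreSequences.

(** * Automorphisms given by the images of the basis *)

Section Substitution.
Variable B : finType.
Local Open Scope group_scope.
Implicit Types (l m : letter B) (g h : free_group B) (u v w : word B) (a : B -> word B).
Implicit Types (Hs : seq (seq (word B))) (gens : seq (word B)).

Definition subst_word a w : word B :=
  flatten [seq if l.2 then winv (a l.1) else a l.1 | l <- w].

Lemma wordg_subst_cat a u v :
  wordg (subst_word a (u ++ v)) = wordg (subst_word a u) * wordg (subst_word a v).
Proof. by rewrite /subst_word map_cat flatten_cat wordg_cat. Qed.

Lemma wordg_subst_linv a l :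
  wordg (subst_word a [:: linv l]) = (wordg (subst_word a [:: l]))^-1.
Proof.
by rewrite /subst_word /= !cats0 -wordg_winv; case: l => b [] /=; rewrite ?winvK.
Qed.

Lemma wordg_subst_reduce a w : wordg (subst_word a (reduce w)) = wordg (subst_word a w).
Proof.
elim: w => [//|l w IH] /=; rewrite -/(reduce w) -(cat1s l w) wordg_subst_cat -IH.
case: (reduce w) => [|m v] /=; first by rewrite -(wordg_subst_cat a [:: l] [::]).
case: eqP => [->|_]; last by rewrite -wordg_subst_cat.
by rewrite -(cat1s (linv l) v) wordg_subst_cat wordg_subst_linv mulVKg.
Qed.

Definition substg a g : free_group B := wordg (subst_word a (val g)).

Fact substg_morphism a : monoid_morphism (substg a).
Proof. by split=> // g h; rewrite /substg val_mul wordg_subst_reduce wordg_subst_cat. Qed.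

HB.instance Definition _ a :=
  isUMagmaMorphism.Build (free_group B) (free_group B) (substg a) (substg_morphism a).

Lemma substg_letterg a l :
  substg a (letterg l) = if l.2 then (wordg (a l.1))^-1 else wordg (a l.1).
Proof. by rewrite /substg /subst_word /= cats0; case: l.2; rewrite ?wordg_winv. Qed.

Lemma wordg_ext a w : wordg (ext a w) = substg a (wordg w).
Proof.
by rewrite /substg val_wordg wordg_subst_reduce; apply: val_inj; rewrite !val_wordg reduceK.
Qed.

Lemma extE a w : ext a w = val (substg a (wordg w)).
Proof. by rewrite -wordg_ext val_wordg reduceK. Qed.

Lemma substg_comp a a' g : substg (fun b => ext a (a' b)) g = substg a (substg a' g).
Proof.
elim/free_group_ind: g => [|g l IH]; first by rewrite !gmulf1.
rewrite !gmulfM /= IH !substg_letterg wordg_ext; congr (_ * _).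
by case: l.2; rewrite ?gmulfV.
Qed.

Lemma is_autP a :
  is_aut a <-> exists a', cancel (substg a) (substg a') /\ cancel (substg a') (substg a).
Proof.
split=> -[a' inv_a']; exists a'.
  by split=> g; apply: val_inj; have := inv_a' _ (reduced_val g);
    rewrite !extE !val_wordgK => -[].
by case: inv_a' => aK a'K w rw; rewrite !extE !val_wordgK aK a'K val_wordg_reduced.
Qed.

Lemma is_aut_comp a a' : is_aut a -> is_aut a' -> is_aut (fun b => ext a (a' b)).
Proof.
move=> /is_autP[c [aK cK]] /is_autP[c' [a'K c'K]]; apply/is_autP.
by exists (fun b => ext c' (c b)); split=> g; rewrite !substg_comp ?aK ?a'K ?c'K ?cK.
Qed.

Lemma aut_act_comp a a' Hs : aut_act (fun b => ext a (a' b)) Hs = aut_act a (aut_act a' Hs).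
Proof.
rewrite /aut_act -map_comp; apply: eq_map => gens /=; rewrite -map_comp.
by apply: eq_map => w /=; rewrite !extE val_wordgK substg_comp.
Qed.

Section Image.
Variables (a : B -> word B) (f' : endomorphism B).
Hypotheses (aK : cancel (substg a) f') (f'K : cancel f' (substg a)).

Lemma generated_map_ext gens g : generated (map (ext a) gens) g <-> generated gens (f' g).
Proof.
have genE x : x.1 < size gens ->
    wordg (signed_gen (map (ext a) gens) x) = substg a (wordg (signed_gen gens x)).
  move=> lx; rewrite /signed_gen (nth_map [::]) //; case: x.2; last exact: wordg_ext.
  by rewrite !wordg_winv wordg_ext gmulfV.
split=> [|Kg].
  elim/generated_ind=> [|x k]; first by rewrite gmulf1; apply: generated1.
  by rewrite size_map => lx _ IH; rewrite gmulfM genE // aK; apply: generated_mulgen.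
rewrite -(f'K g); elim/generated_ind: Kg => [|x k lx _ IH].
  by rewrite gmulf1; apply: generated1.
by rewrite gmulfM /= -genE //; apply: generated_mulgen; rewrite ?size_map.
Qed.

Lemma subgroup_at_aut_act Hs j : subgroup_at (aut_act a Hs) j = subgroup_at Hs j \o f'.
Proof.
apply: funext => g; apply: propext; rewrite /subgroup_at /aut_act /=.
have [lj|gj] := ltnP j (size Hs).
  by rewrite (nth_map [::]) //; apply: generated_map_ext.
by rewrite !nth_default ?size_map //; apply: (generated_map_ext [::]).
Qed.

End Image.

End Substitution.

(** * Whitehead automorphisms *)

Section Whitehead.
Variable B : finType.
Local Open Scope group_scope.
Variables (D : pred (letter B)) (b : B).
Hypotheses (Db : D (b, false)) (DbV : ~~ D (b, true)).
Implicit Types (l m : letter B) (g h : free_group B) (c : B) (s : bool).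

(* [c] goes to [c], [b c], [c b^-1] or [b c b^-1], according to whether [c] and [c^-1]
   lie in [D]; the inverse automorphism is obtained for [s = true]. *)
Definition whitehead s c : word B :=
  if c == b then [:: (b, false)] else
  (if D (c, false) then [:: (b, s)] else [::]) ++ (c, false) ::
  (if D (c, true) then [:: (b, ~~ s)] else [::]).

Lemma whitehead_letter s l : substg (whitehead s) (letterg l) =
  if l.1 == b then letterg l else
  (if D l then letterg (b, s) else 1) * letterg l *
  (if D (linv l) then letterg (b, ~~ s) else 1).
Proof.
rewrite substg_letterg /whitehead; case: l => c t /=; case: eqP => [->|_].
  by case: t; rewrite // -wordg_winv.
have wordg_if (d : bool) m :
    wordg (if d then [:: m] else [::]) = if d then letterg m else 1.
  by case: d.
case: t; rewrite wordg_cat wordg_cons !wordg_if; last by rewrite mulgA.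
rewrite !invgM -!letterg_linv /linv /=.
by do 2!case: ifP => _; rewrite ?invg1 -?letterg_linv /linv /= ?negbK.
Qed.

Lemma whiteheadK s : cancel (substg (whitehead s)) (substg (whitehead (~~ s))).
Proof.
move=> g; elim/free_group_ind: g => [|g l IH]; first by rewrite !gmulf1.
rewrite !gmulfM /= IH; congr (_ * _); rewrite whitehead_letter.
have [e|ne] := eqVneq l.1 b; first by rewrite whitehead_letter e eqxx.
have fix_b t : substg (whitehead (~~ s)) (letterg (b, t)) = letterg (b, t).
  by rewrite whitehead_letter eqxx.
have bV t : letterg (b, ~~ t) = (letterg (b, t))^-1 by rewrite -letterg_linv.
rewrite !gmulfM /= whitehead_letter (negbTE ne) negbK.
do 2!case: ifP => _; rewrite ?fix_b ?gmulf1 ?mulg1 ?mul1g //.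
- by rewrite bV !mulgA mulgV mul1g mulgK.
- by rewrite bV !mulgA mulgV mul1g.
- by rewrite bV mulgK.
Qed.

Lemma is_aut_whitehead : is_aut (whitehead false).
Proof.
apply/is_autP; exists (whitehead true).
by split; [apply: whiteheadK | apply: (@whiteheadK true)].
Qed.

Local Notation phi := (substg (whitehead false)).
Let a : free_group B := letterg (b, false).

Lemma whitehead_eq1 g : (phi g == 1) = (g == 1).
Proof. exact: gmulf_eq1 (can_inj (@whiteheadK false)). Qed.

Lemma whitehead_letter_split l : phi (letterg l) =
  (if D l then a else 1) * (if l.1 == b then 1 else letterg l) *
  (if D (linv l) then a^-1 else 1).
Proof.
have aV : letterg (b, true) = a^-1 by rewrite -letterg_linv.
rewrite whitehead_letter /= aV; case: eqP => // lb.
by case: l lb => c [] /= ->; rewrite /linv /= Db (negbTE DbV) ?mulg1 ?mul1g ?aV.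
Qed.

Lemma whitehead_cone g : starts [:: (b, false)] (phi g) = cone D g.
Proof.
have starts_a h : starts [:: (b, false)] (h * a) = starts [:: (b, false)] h (+) (h == 1).
  by rewrite starts1_mul_letterg eqxx andbT /linv /= xpair_eqE andbF andbF addbF.
have starts_aV h :
    starts [:: (b, false)] (h * a^-1) = starts [:: (b, false)] h (+) (h * a^-1 == 1).
  by rewrite -{2}(mulgVK a h) starts_a -addbA addbb addbF.
move: g; apply: cone_unique => [|g l]; first by rewrite gmulf1.
rewrite -(whitehead_eq1 g) -(whitehead_eq1 (g * _)) gmulfM /=.
have front : starts [:: (b, false)] (phi g * (if D l then a else 1)) =
    starts [:: (b, false)] (phi g) (+) ((phi g == 1) && D l).
  by case: ifP => _; rewrite ?starts_a ?mulg1 ?andbT ?andbF ?addbF.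
rewrite whitehead_letter_split !mulgA; set h := _ * (if l.1 == b then _ else _).
have middle :
    starts [:: (b, false)] h = starts [:: (b, false)] (phi g * (if D l then a else 1)).
  by rewrite /h; case: eqP => [_|/eqP ne]; rewrite ?mulg1 // starts1_mul_other.
rewrite -front -middle; case: ifP => _; first by rewrite starts_aV andbT.
by rewrite mulg1 andbF addbF.
Qed.

Lemma whitehead_starts1 c g : c != b ->
  starts [:: (c, false)] ((if D (c, false) then a else 1)^-1 * phi g) =
  starts [:: (c, false)] g.
Proof.
move=> nc; set t := if _ then _ else _.
have drop_a (d : bool) h : starts [:: (c, false)] (h * (if d then a else 1)) =
    starts [:: (c, false)] h.
  by case: d; rewrite ?mulg1 // starts1_mul_other //= eq_sym.
have drop_aV (d : bool) h : starts [:: (c, false)] (h * (if d then a^-1 else 1)) =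
    starts [:: (c, false)] h.
  by case: d; rewrite ?mulg1 // -letterg_linv starts1_mul_other //= eq_sym.
rewrite -[RHS]cone1; move: g; apply: cone_unique => [|g l].
  by rewrite gmulf1 -(drop_a (D (c, false))) -/t mulg1 mulVg.
rewrite -(whitehead_eq1 g) -(whitehead_eq1 (g * _)) gmulfM /=.
rewrite {1}whitehead_letter_split !mulgA drop_aV.
have [lb|nlb] := eqVneq l.1 b.
  have [/negbTE nl /negbTE nlV] : l != (c, false) /\ linv l != (c, false).
    by split; apply: contraNneq nc => lc; rewrite -lb -[l.1]/((linv l).1) ?lc.
  by rewrite mulg1 drop_a /= nl nlV !andbF !addbF.
rewrite starts1_mul_letterg drop_a /=; congr (_ (+) _ (+) _).
  have [lc|_] := eqVneq l (c, false); last by rewrite !andbF.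
  by rewrite !andbT lc -/t -mulgA -conjgE conjg_eq1.
have [lc|_] := eqVneq (linv l) (c, false); last by rewrite !andbF.
rewrite !andbT [phi (letterg l)]whitehead_letter_split (negbTE nlb) lc -[RHS](conjg_eq1 _ t).
by rewrite conjgE /t; case: ifP => _; rewrite ?mulg1 !mulgA ?mulgVK.
Qed.

End Whitehead.

Definition whitehead_minimal (B : finType) (Gs : seq (lgraph B)) :=
  forall (D : pred (letter B)) (l : letter B),
    D l -> ~~ D (linv l) -> nlab l.1 Gs <= capacity D Gs.

Section Minimality.
Variable B : finType.
Local Open Scope group_scope.
Implicit Types (Hs : seq (seq (word B))) (Gs : seq (lgraph B)) (D : pred (letter B)).

Section WhiteheadImage.
Variables (D : pred (letter B)) (b : B).
Hypotheses (Db : D (b, false)) (DbV : ~~ D (b, true)).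
Variables (Hs : seq (seq (word B))) (Gs Gs' : seq (lgraph B)).
Hypotheses (sG : sigma_seq Hs Gs) (sG' : sigma_seq (aut_act (whitehead D b false) Hs) Gs').

Let capacity_image Q Q' t :
  (forall g, cone Q' (t^-1 * substg (whitehead D b false) g) = cone Q g) ->
  capacity Q' Gs' <= capacity Q Gs.
Proof.
have [at_coset lab] := sequence_labelling_exists sG.
have [at_coset' lab'] := sequence_labelling_exists sG'.
have wK : cancel (substg (whitehead D b false)) (substg (whitehead D b true)).
  exact: whiteheadK.
have wK' := @whiteheadK _ D b true.
apply: (capacity_transport wK wK' _ _ lab lab'); first by rewrite size_map.
exact: subgroup_at_aut_act.
Qed.

Lemma nlab_whitehead : nlab b Gs' <= capacity D Gs.
Proof.
have [at_coset' lab'] := sequence_labelling_exists sG'.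
rewrite (nlab_capacity lab' (b, false)) //; apply: (capacity_image (t := 1)) => g.
by rewrite invg1 mul1g cone1 whitehead_cone.
Qed.

Lemma nlab_whitehead_other c : c != b -> nlab c Gs' <= nlab c Gs.
Proof.
move=> nc; have [at_coset lab] := sequence_labelling_exists sG.
have [at_coset' lab'] := sequence_labelling_exists sG'.
rewrite (nlab_capacity lab (c, false)) // (nlab_capacity lab' (c, false)) //.
apply: (capacity_image (t := if D (c, false) then letterg (b, false) else 1)) => g.
by rewrite !cone1 whitehead_starts1.
Qed.

End WhiteheadImage.

Lemma gersten_whitehead_minimal beta Hs Gs :
  gersten beta Hs -> sigma_seq (aut_act beta Hs) Gs -> whitehead_minimal Gs.
Proof.
move=> [autb minb] sG.
have positive D b : D (b, false) -> ~~ D (b, true) -> nlab b Gs <= capacity D Gs.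
  move=> Db DbV; have := minb _ (is_aut_comp (is_aut_whitehead D b) autb).
  rewrite aut_act_comp => /(_ Gs) min_whitehead.
  have [Gs' sG'] := sigma_exists (aut_act (whitehead D b false) (aut_act beta Hs)).
  have := min_whitehead _ sG sG'; rewrite !total_edges_sum_nlab.
  rewrite (bigD1 b) //= [X in _ <= X](bigD1 b) //=.
  have le_other : (\sum_(c | c != b) nlab c Gs' <= \sum_(c | c != b) nlab c Gs)%N.
    by apply: leq_sum => c; apply: nlab_whitehead_other sG sG' _.
  have := nlab_whitehead Db DbV sG sG'; lia.
move=> D [b []] Dl DlV; last exact: positive.
by rewrite -capacity_predC; apply: positive => //=; rewrite negbK.
Qed.

End Minimality.

(** * Monochromatic directions of a colouring *)

Section Monochromatic.
Variable B : finType.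
Local Open Scope group_scope.
Implicit Types (l m a : letter B) (u v w : word B) (g h p y : free_group B).
Implicit Types (X : pred (free_group B)) (A : pred (letter B)) (c d : bool).

Definition attains X u c := infinitely_many (fun g => starts u g /\ X g = c).
Definition monochromatic X u c := almost_all (fun g => starts u g -> X g = c).
Definition bichromatic X u := forall c, attains X u c.

Lemma not_attains X u c : ~ attains X u c -> monochromatic X u (~~ c).
Proof.
move=> /not_infinitely_many; apply: almost_allW => g nXg ug.
by apply/eqP; apply: contra_notT nXg; case: (X g) c => -[].
Qed.

Lemma not_bichromatic X u : ~ bichromatic X u -> exists c, monochromatic X u c.
Proof. by case/existsNP=> c /not_attains; exists (~~ c). Qed.

Lemma attains_monochromatic X u c d : attains X u c -> monochromatic X u d -> c = d.
Proof.
move=> Xuc [M Xud]; have [g lg [ug <-]] := Xuc M.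
exact: Xud.
Qed.

Lemma monochromatic_inj X l c d :
  monochromatic X [:: l] c -> monochromatic X [:: l] d -> c = d.
Proof.
move=> Xc; apply: attains_monochromatic.
apply: infinitely_many_sub (infinitely_many_starts1 l).
by apply: almost_allW Xc => g Xg lg; split=> //; apply: Xg.
Qed.

Lemma attainsW X u v c : attains X (u ++ v) c -> attains X u c.
Proof. by apply: infinitely_manyW => g [/startsW]. Qed.

Lemma attains_next X u c : attains X u c ->
  exists2 l, reduced (rcons u l) & attains X (rcons u l) c.
Proof.
move=> Xu; have [|l Xl] := @infinitely_many_exists B _
    (fun l g => starts (rcons u l) g /\ X g = c).
  apply: infinitely_many_sub Xu; exists (size u).+1 => g lg [ug Xg].
  by have [l ulg] := starts_next ug lg; exists l.
exists l => //; have [g _ [+ _]] := Xl 0.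
exact: reduced_starts.
Qed.

Lemma reduced_bichromatic X u : bichromatic X u -> reduced u.
Proof. by move=> /(_ true 0)[g _ [/reduced_starts]]. Qed.

Lemma bichromatic_size X : tame X -> exists N, forall u, bichromatic X u -> size u < N.
Proof.
case/tame_starts_const=> N constX; exists N => u Xu; rewrite ltnNge; apply/negP => Nu.
have [g _ [ug gT]] := Xu true 0; have [h _ [uh hF]] := Xu false 0.
by move: gT; rewrite (constX u g) // -(constX u h) // hF.
Qed.

Definition translate X y : pred (free_group B) := fun g => X (y * g).

Lemma translateM X y h : translate (translate X y) h = translate X (y * h).
Proof. by apply: funext => g; rewrite /translate mulgA. Qed.

Lemma translate1 X : translate X 1 = X.
Proof. by apply: funext => g; rewrite /translate mul1g. Qed.

Lemma monochromatic_translate X p u c : monochromatic (translate X p) u c <->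
  almost_all (fun g => starts u (p^-1 * g) -> X g = c).
Proof.
split=> [/(almost_all_comp (proper_mull p^-1))|/(almost_all_comp (proper_mull p))];
  apply: almost_allW => g /=; rewrite ?mulKg //.
by rewrite /translate mulVKg.
Qed.

Lemma monochromatic_translate_next X p l c : reduced (rcons (val p) l) ->
  monochromatic (translate X p) [:: l] c <-> monochromatic X (rcons (val p) l) c.
Proof.
move=> rl; rewrite monochromatic_translate.
by split; apply: almost_allW => g; rewrite starts_letter_mulV.
Qed.

Lemma monochromatic_translate_last X p u m c : val p = rcons u m ->
  monochromatic (translate X p) [:: linv m] c <->
  almost_all (fun g => ~~ starts (val p) g -> X g = c).
Proof.
move=> pE; rewrite monochromatic_translate.
by split; apply: almost_allW => g; rewrite (starts_last_mulV _ pE).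
Qed.

Definition side X A c l := ~~ A l && `[< monochromatic X [:: l] c >].

Lemma sideP X A c l : reflect (~~ A l /\ monochromatic X [:: l] c) (side X A c l).
Proof. by apply: (iffP andP) => -[? /asboolP]. Qed.

Lemma side_colour X A c l : side X A c l -> side X A (~~ c) l = false.
Proof.
case/sideP=> _ Xc; apply/negP => /sideP[_ /(monochromatic_inj Xc)].
by case: c {Xc}.
Qed.

Lemma meets_side (K : free_group B -> Prop) X A c l :
  side X A c l -> direction K l -> meets K (fun g => X g == c).
Proof.
by case/sideP=> _ Xl; apply: meets_sub; apply: almost_allW Xl => g Xg /Xg/eqP.
Qed.

Lemma side_almost_all X A :
  almost_all (fun g => forall l c, side X A c l -> starts [:: l] g -> X g = c).
Proof.
apply: almost_all_forall => l; apply: almost_all_forall => c.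
have [/sideP[_]|nside] := boolP (side X A c l); last by exists 0.
by apply: almost_allW => g Xg _.
Qed.

Definition two_coloured_off X A :=
  (forall l, ~~ A l -> exists c, side X A c l) /\ (forall c, exists l, side X A c l).

Lemma side_or X A c l : two_coloured_off X A -> ~~ A l -> side X A c l \/ side X A (~~ c) l.
Proof. by case=> all_side _ /all_side[[] Xl]; case: c; auto. Qed.

Lemma two_coloured_off0 X a : two_coloured_off X (pred1 a) -> ~ bichromatic X [:: a] ->
  two_coloured_off X pred0.
Proof.
move=> [all_side both] /not_bichromatic[d Xa]; split=> [l _|c]; last first.
  by have [l /sideP[_ Xl]] := both c; exists l; apply/sideP.
have [->|/all_side[c /sideP[_ Xl]]] := eqVneq l a; first by exists d; apply/sideP.
by exists c; apply/sideP.
Qed.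

Definition longest_bichromatic X p :=
  bichromatic X (val p) /\ forall q, bichromatic X (val q) -> len q <= len p.

Lemma longest_bichromatic_exists X : tame X -> bichromatic X [::] ->
  exists p, longest_bichromatic X p.
Proof.
move=> tX bX; have [N ltN] := bichromatic_size tX.
have [|u Xu maxu] := @exists_max_size _ (bichromatic X) N _ ltN; first by exists [::].
have ru := reduced_bichromatic Xu; exists (wordg u).
rewrite /longest_bichromatic /len val_wordg_reduced //.
by split=> // q /maxu.
Qed.

(* The letters [l] such that [rcons (val p) l] is not reduced are the letter leading from
   [p] back towards [1], and none if [p = 1]. *)
Lemma two_coloured_longest X p : longest_bichromatic X p ->
  two_coloured_off (translate X p) (fun l => ~~ reduced (rcons (val p) l)).
Proof.
move=> [bX maxp]; have next_mono l : exists c, monochromatic X (rcons (val p) l) c.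
  apply: not_bichromatic => bXl; have rl := reduced_bichromatic bXl.
  have := maxp (wordg (rcons (val p) l)); rewrite val_wordg_reduced // => /(_ bXl).
  by rewrite /len val_wordg_reduced // size_rcons ltnn.
split=> [l /negPn rl|c].
  have [c Xl] := next_mono l; exists c; apply/sideP; rewrite negbK.
  by split=> //; apply/monochromatic_translate_next.
have [l rl Xlc] := attains_next (bX c); have [d Xld] := next_mono l.
exists l; apply/sideP; rewrite negbK (attains_monochromatic Xlc Xld).
by split=> //; apply/monochromatic_translate_next.
Qed.

(* [1] is a leaf of the subtree spanned by the edges across which both colours occur
   arbitrarily far away on both sides. *)
Definition leaf X a := two_coloured_off X (pred1 a) /\ bichromatic X [:: a].

Lemma two_coloured_longest_rcons X p u m : longest_bichromatic X p -> val p = rcons u m ->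
  two_coloured_off (translate X p) (pred1 (linv m)).
Proof.
move=> /two_coloured_longest + pE.
rewrite (_ : (fun l => _) = pred1 (linv m) :> pred _) //; apply: funext => l /=.
by rewrite pE reduced_rcons2 -pE reduced_val andbT negbK.
Qed.

Lemma bichromatic_behind X a p u m : two_coloured_off X (pred1 a) ->
  val p = rcons u m -> head m u = a -> bichromatic (translate X p) [:: linv m].
Proof.
move=> [_ both] pE ha c; apply: contrapT => /not_attains.
move/(monochromatic_translate_last _ _ pE) => Xoff; have [l /sideP[/= nla Xl]] := both c.
suff /(monochromatic_inj Xl) : monochromatic X [:: l] (~~ c) by case: (c).
apply: almost_allW Xoff => g Xg lg; apply: Xg; apply: contra nla.
by rewrite pE => /starts_head; rewrite ha (starts1_eq _ lg) eq_sym.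
Qed.

Lemma exists_leaf X : tame X -> bichromatic X [::] ->
  exists p, two_coloured_off (translate X p) pred0 \/ exists a, leaf (translate X p) a.
Proof.
move=> tX /(longest_bichromatic_exists tX)[p maxp]; exists p.
case/lastP pE: (val p) => [|u m].
  left; have := two_coloured_longest maxp; rewrite pE.
  by rewrite (_ : (fun l => _) = pred0 :> pred _) //; apply: funext => l; rewrite reduced1.
have off := two_coloured_longest_rcons maxp pE.
have [bX|nX2] := pselect (bichromatic (translate X p) [:: linv m]).
  by right; exists (linv m).
by left; apply: two_coloured_off0 off nX2.
Qed.

Lemma exists_opposite_leaf X a : tame X -> leaf X a -> exists p u m,
  [/\ val p = rcons u m, head m u = a & leaf (translate X p) (linv m)].
Proof.
move=> tX [off bXa]; have [all_side _] := off.
have bX : bichromatic X [::] by move=> c; apply: (@attainsW _ _ [:: a]).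
have [p maxp] := longest_bichromatic_exists tX bX; exists p.
case/lastP pE: (val p) => [|u m].
  have := maxp.2 (letterg a); rewrite val_letterg => /(_ bXa).
  by rewrite /len pE val_letterg.
exists u, m; have ha : head m u = a.
  apply/eqP; apply: contraT => /all_side[c /sideP[_ Xc]].
  have : attains X [:: head m u] (~~ c).
    apply: (@attainsW _ _ (behead (rcons u m))).
    by have := maxp.1 (~~ c); rewrite pE; case: (u).
  by move=> /attains_monochromatic/(_ Xc); case: (c).
split=> //; split; first exact: two_coloured_longest_rcons pE.
exact: bichromatic_behind off pE ha.
Qed.

End Monochromatic.

(** * Separating colourings *)

Section Parity.
Variable T : eqType.
Implicit Types (P Q : pred T) (b c : bool).

Definition has_parity P b :=
  exists s : seq T, [/\ uniq s, forall x, (x \in s) = P x & odd (size s) = b].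

Lemma has_parity_inj P b c : has_parity P b -> has_parity P c -> b = c.
Proof.
move=> [s [us sP <-]] [t [ut tP <-]]; congr odd; apply: perm_size.
by apply: uniq_perm => // x; rewrite sP tP.
Qed.

Lemma eq_has_parity P Q b : P =1 Q -> has_parity P b -> has_parity Q b.
Proof.
by move=> PQ [s [us sP os]]; exists s; split=> // x; rewrite sP PQ.
Qed.

Lemma has_parity0 : has_parity pred0 false.
Proof. by exists [::]. Qed.

Lemma has_parity1 x : has_parity (pred1 x) true.
Proof. by exists [:: x]; split=> // y; rewrite inE. Qed.

Lemma has_parityD P Q b c : has_parity P b -> has_parity Q c ->
  has_parity (fun x => P x (+) Q x) (b (+) c).
Proof.
move=> [s [us sP <-]] [t [ut tQ <-]].
exists ([seq x <- s | x \notin t] ++ [seq x <- t | x \notin s]); split.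
- rewrite cat_uniq !filter_uniq //= andbT; apply/hasPn => x.
  by rewrite !mem_filter => /andP[/negbTE-> _]; rewrite andbF.
- move=> x; rewrite mem_cat !mem_filter sP tQ.
  by case: (P x); case: (Q x).
have common : count (mem t) s = count (mem s) t.
  rewrite -!size_filter; apply: perm_size; apply: uniq_perm; rewrite ?filter_uniq //.
  by move=> x; rewrite !mem_filter /= andbC.
rewrite size_cat !size_filter oddD.
have := count_predC (mem t) s; have := count_predC (mem s) t; rewrite common => <- <-.
by rewrite !oddD; case: (odd (count (mem s) t)); do 2!case: (odd _).
Qed.

Lemma has_parity_comp f f' P b : cancel f f' -> cancel f' f -> has_parity P b ->
  has_parity (P \o f) b.
Proof.
move=> fK f'K [s [us sP os]]; exists (map f' s); split.
- by rewrite map_inj_uniq //; apply: can_inj f'K.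
- by move=> x; rewrite -{1}(fK x) (mem_map (can_inj f'K)) sP.
- by rewrite size_map.
Qed.

End Parity.

Section Separating.
Variable B : finType.
Local Open Scope group_scope.
Implicit Types (l m : letter B) (g h y : free_group B) (X Y : pred (free_group B)).

(* The sphere dual to [X] meets every loop an even number of times: it is null-homologous
   mod 2. *)
Definition separating X := forall h, has_parity (fun g => X g (+) X (g * h)) false.

Lemma separating_translate X y : separating (translate X y) -> separating X.
Proof.
move=> sX h; have := has_parity_comp (mulVKg y) (mulKg y) (sX h).
by apply: eq_has_parity => g; rewrite /= /translate mulVKg !mulgA mulgV mul1g.
Qed.

Lemma separatingD X Y : separating X -> separating Y -> separating (fun g => X g (+) Y g).
Proof.
move=> sX sY h; have := has_parityD (sX h) (sY h); apply: eq_has_parity => g.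
by rewrite -!addbA; congr (_ (+) _); rewrite addbCA.
Qed.

Lemma separating_const c : separating (fun=> c).
Proof. by move=> h; apply: eq_has_parity (has_parity0 _) => g; rewrite addbb. Qed.

Fixpoint words_upto n : seq (word B) :=
  if n is n'.+1 then [::] :: [seq l :: w | l <- enum {: letter B}, w <- words_upto n']
  else [:: [::]].

Definition ball n : seq (free_group B) := map (@wordg B) (words_upto n).

Lemma mem_ball n g : len g <= n -> g \in ball n.
Proof.
move=> lg; apply/mapP; exists (val g); last by rewrite val_wordgK.
move: lg; rewrite /len; elim: n (val g) => [|n IH] [|l w] //= lw.
by rewrite inE; apply/orP; right; apply: allpairs_f; rewrite ?mem_enum ?IH.
Qed.

Lemma separating_finite X : almost_all (fun g => X g = false) -> separating X.
Proof.
move=> [M X0] h; have [b Xb] : exists b, has_parity X b.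
  exists (odd (size (undup (filter X (ball M))))), (undup (filter X (ball M))).
  split=> //; first exact: undup_uniq.
  move=> g; rewrite mem_undup mem_filter; case Xg: (X g) => //=.
  by apply: mem_ball; rewrite leqNgt; apply/negP => /ltnW/X0; rewrite Xg.
rewrite -(addbb b); apply: has_parityD => //.
exact: (has_parity_comp (mulgK h) (mulgVK h)).
Qed.

Lemma separating_almost_all X Y :
  almost_all (fun g => X g = Y g) -> separating Y -> separating X.
Proof.
move=> XY sY; have sXY : separating (fun g => X g (+) Y g).
  by apply: separating_finite; apply: almost_allW XY => g ->; rewrite addbb.
by move=> h; apply: eq_has_parity (separatingD sXY sY h) => g; rewrite !addbK.
Qed.

Lemma separating_cone (C : pred (letter B)) : linv_closed C -> separating (cone C).
Proof.
move=> Cinv; have CE l : C (linv l) = C l.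
  by apply/idP/idP => /Cinv //; rewrite linvK.
have separating_letter l : has_parity (fun g => cone C g (+) cone C (g * letterg l)) false.
  have [Cl|nCl] := boolP (C l); last first.
    apply: eq_has_parity (has_parity0 _) => g; rewrite cone_mul_letterg CE (negbTE nCl).
    by rewrite !andbF !addbF addbb.
  apply: (@eq_has_parity _ (fun g => (g == 1) (+) (g == (letterg l)^-1))).
    by move=> g; rewrite cone_mul_letterg CE Cl !andbT mulg_eq1 -addbA addKb.
  by rewrite -(addbb true); apply: has_parityD; apply: has_parity1.
move=> h; elim/free_group_ind: h => [|h l IH].
  by apply: eq_has_parity (has_parity0 _) => g; rewrite mulg1 addbb.
have := has_parityD IH (has_parity_comp (mulgK h) (mulgVK h) (separating_letter l)).
by apply: eq_has_parity => g; rewrite /= -addbA addKb mulgA.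
Qed.

Lemma not_separating_starts (f : endomorphism B) f' l :
  cancel f f' -> cancel f' f -> ~ separating (starts [:: l] \o f).
Proof.
move=> fK f'K /(_ (f' (letterg l))) /has_parity_inj even_1.
suff /even_1 : has_parity (fun g => (starts [:: l] \o f) g (+)
  (starts [:: l] \o f) (g * f' (letterg l))) true by [].
apply: eq_has_parity (has_parity1 1) => g; rewrite /= gmulfM f'K starts1_mul_letterg.
by rewrite eqxx andbT (negbTE (linv_neq l)) andbF addbF addKb (gmulf_eq1 _ (can_inj fK)).
Qed.

End Separating.

Section Branch.
Variable B : finType.
Local Open Scope group_scope.
Implicit Types (l m a : letter B) (g h v y : free_group B) (X : pred (free_group B)).
Implicit Types (A : pred (letter B)) (c : bool).

(* The branch vertices span the finite part of the Cayley tree in which the colour of [X]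
   changes; surgery decreases their number. *)
Definition branch X v :=
  forall l c, ~ forall m, m != l -> monochromatic (translate X v) [:: m] c.

Lemma branch_translate X y v : branch (translate X y) v -> branch X (y * v).
Proof. by rewrite /branch translateM. Qed.

Lemma branch_finite X : tame X ->
  exists s : seq (free_group B), forall v, branch X v -> v \in s.
Proof.
case/tame_starts_const=> N constX; exists (ball B N) => v Xv; apply: mem_ball.
rewrite leqNgt; apply/negP => Nv; case/lastP vE: (val v) => [|u m].
  by move: Nv; rewrite /len vE.
apply: (Xv (linv m) (X v)) => m' nm'; apply/monochromatic_translate_next.
  by rewrite vE reduced_rcons2 nm' -vE reduced_val.
exists 0 => g _; rewrite -cats1 => /startsW/constX -> //; first by rewrite val_wordgK.
exact: ltnW.
Qed.

Lemma leaf_branch X a : leaf X a -> branch X 1.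
Proof.
move=> [[_ both] bXa] l c; rewrite translate1 => Xc; have [la|nla] := eqVneq a l.
  have [m /sideP[/= nm Xm]] := both (~~ c); rewrite la in nm.
  by have := monochromatic_inj Xm (Xc m nm); case: (c).
by have := attains_monochromatic (bXa (~~ c)) (Xc a nla); case: (c).
Qed.

Definition erase X A c : pred (free_group B) := fun g => if cone A g then X g else c.

Lemma tame_erase X A c : tame X -> tame (erase X A c).
Proof.
move=> tX; apply: almost_allW (almost_all_and tX (tame_cone A)) => g [Xg Ag] l.
by rewrite /erase Xg Ag.
Qed.

Lemma erase_starts X A c l g : starts [:: l] g -> erase X A c g = if A l then X g else c.
Proof. by rewrite /erase => /cone_starts->. Qed.

Lemma bichromatic_erase X a c :
  bichromatic X [:: a] -> bichromatic (erase X (pred1 a) c) [::].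
Proof.
move=> bXa d; apply: infinitely_manyW (bXa d) => g [ag Xg].
by rewrite /starts prefix0s (erase_starts _ _ _ ag) /= eqxx.
Qed.

Lemma branch_erase X a c v : leaf X a -> branch (erase X (pred1 a) c) v ->
  v != 1 /\ branch X v.
Proof.
move=> [off _] Xv; have v1 : v != 1.
  apply/eqP => v1; apply: (Xv a c) => m nm; rewrite v1 translate1.
  by exists 0 => g _ mg; rewrite (erase_starts _ _ _ mg) /= (negbTE nm).
split=> // l d Xd; case/lastP vE: (val v) v1 => [|u m] v1.
  by case/eqP: v1; apply: val_inj.
have next m' : m' != linv m -> reduced (rcons (val v) m').
  by move=> nm'; rewrite vE reduced_rcons2 nm' -vE reduced_val.
have head_starts m' g : starts (rcons (val v) m') g -> starts [:: head m u] g.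
  by rewrite -cats1 => /startsW; rewrite vE => /starts_head.
have [ha|nha] := eqVneq (head m u) a; last first.
  apply: (Xv (linv m) c) => m' /next rm'; apply/monochromatic_translate_next => //.
  by exists 0 => g _ /head_starts hg; rewrite (erase_starts _ _ _ hg) /= (negbTE nha).
have [lm|nlm] := eqVneq (linv m) l; last first.
  have := bichromatic_behind off vE ha (~~ d).
  by move/attains_monochromatic/(_ (Xd _ nlm)); case: (d).
apply: (Xv (linv m) d) => m' nm'; have rm' := next _ nm'.
rewrite lm in nm'; apply/monochromatic_translate_next => //.
have /(monochromatic_translate_next _ _ rm') := Xd _ nm'; apply: almost_allW => g Xg vg.
by rewrite (erase_starts _ _ _ (head_starts _ _ vg)) /= ha eqxx Xg.
Qed.

Lemma separating_erase X A c :
  two_coloured_off X A -> linv_closed (side X A (~~ c)) ->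
  separating (erase X A c) -> separating X.
Proof.
move=> off Cinv sE; apply: separating_almost_all (separatingD sE (separating_cone Cinv)).
have := almost_all_and (side_almost_all X A) (almost_all_longer B 0).
apply: almost_allW => g [Xg lg]; have [l /= lg1] := starts_next (prefix0s _) lg.
rewrite (erase_starts _ _ _ lg1) (cone_starts _ lg1).
have [Al|nAl] := boolP (A l); first by rewrite /side Al addbF.
have [Xl|Xl] := side_or c off nAl; rewrite (Xg l _ Xl lg1) ?Xl ?addbT //.
by rewrite (side_colour Xl) addbF.
Qed.

End Branch.

(** * Surgery *)

Section Surgery.
Variable B : finType.
Local Open Scope group_scope.
Variables (Hs : seq (seq (word B))) (Gs : seq (lgraph B)).
Variable at_coset : nat -> nat -> free_group B -> Prop.
Hypotheses (sG : sigma_seq Hs Gs) (lab : sequence_labelling Hs Gs at_coset).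
Hypothesis minimal : whitehead_minimal Gs.
Hypothesis minlex_gt1 : forall b : B, 1 < nlab b Gs.
Implicit Types (l m a : letter B) (g h p y : free_group B) (X : pred (free_group B)).
Implicit Types (A C : pred (letter B)) (c : bool) (v : nat * nat).

Lemma capacity_le1_linv_closed C : capacity C Gs <= 1 -> linv_closed C.
Proof.
move=> cap1 l Cl; apply: contraT => nCl; have := leq_trans (minimal Cl nCl) cap1.
by rewrite leqNgt minlex_gt1.
Qed.

Lemma uniquely_crossed_translate X y : tame X ->
  uniquely_crossed Hs X -> uniquely_crossed Hs (translate X y).
Proof.
move=> tX uX j j' g g' lj lj'.
have backE K h : crosses (K :^ h) (translate X y) <-> crosses (K :^ (h / y)) X.
  by rewrite -(crosses_conjugate _ y tX) conjugateM mulgVK.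
rewrite !backE => crossg crossg'; have [ej Kgg'] := uX _ _ _ _ lj lj' crossg crossg'.
by rewrite -(mulgKA y^-1).
Qed.

Definition sees X A c v := [exists l, side X A c l && link Gs v l].
Definition straddles X A v := sees X A false v && sees X A true v.

Lemma straddlesE X A c v : straddles X A v = sees X A c v && sees X A (~~ c) v.
Proof. by rewrite /straddles; case: c => //; rewrite andbC. Qed.

Lemma link_crosses_side X A c v : two_coloured_off X A ->
  link_crosses Gs (side X A c) v -> sees X A c v /\
  (straddles X A v \/ exists2 a, A a & link Gs v a).
Proof.
move=> off /link_crossesP[l [m [Xl nXm vl vm]]].
have seesc : sees X A c v by apply/existsP; exists l; rewrite Xl.
split=> //; have [Am|nAm] := boolP (A m); first by right; exists m.
left; rewrite (straddlesE _ _ c) seesc; apply/existsP; exists m; rewrite vm andbT.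
by have [Xm|//] := side_or c off nAm; rewrite Xm in nXm.
Qed.

Lemma straddles_crosses X A v g : v \in vertices Gs -> at_coset v.1 v.2 g ->
  straddles X A v -> crosses (subgroup_at Hs v.1 :^ g) X.
Proof.
move=> vG vg Xv c; move: Xv; rewrite (straddlesE _ _ c).
case/andP=> /existsP[l /andP[Xl vl]] _; apply: meets_side Xl _.
by apply/(vertex_link lab _ (vertex_index lab vG) vg).
Qed.

Lemma straddles_unique X A : uniquely_crossed Hs X ->
  {in vertices Gs &, forall v v', straddles X A v -> straddles X A v' -> v = v'}.
Proof.
move=> uX [j x] [j' x'] vG v'G Xv Xv'.
have [g vg] := vertex_coset lab vG; have [g' vg'] := vertex_coset lab v'G.
have lj := vertex_index lab vG; have lj' := vertex_index lab v'G.
have crossg := straddles_crosses vG vg Xv; have crossg' := straddles_crosses v'G vg' Xv'.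
have [/= ej Kgg'] := uX _ _ _ _ lj lj' crossg crossg'.
by subst j'; congr (_, _); apply/(coset_eq (lab.2 j lj) vg vg').
Qed.

Lemma capacity_side_le1 X A c : uniquely_crossed Hs X ->
  {in vertices Gs, forall v, link_crosses Gs (side X A c) v -> straddles X A v} ->
  capacity (side X A c) Gs <= 1.
Proof.
move=> uX sub; rewrite leqNgt; apply/count_gt1P => [|[v [v' [nvv' vG v'G Xv Xv']]]].
  exact: uniq_vertices.
by case/eqP: nvv'; apply: (straddles_unique uX vG v'G (sub v vG Xv) (sub v' v'G Xv')).
Qed.

(* Recolouring [X] outside the directions [A] by the colour [c] is a surgery: it yields
   a simpler colouring, still crossed at most once and in the same homology class. *)
Definition surgery_site X A c :=
  [/\ two_coloured_off X A, capacity (side X A (~~ c)) Gs <= 1 &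
      {in vertices Gs, forall v a, A a -> link Gs v a -> sees X A c v}].

Lemma surgery_site0 X c : two_coloured_off X pred0 -> uniquely_crossed Hs X ->
  surgery_site X pred0 c.
Proof.
move=> off uX; split=> //; apply: capacity_side_le1 uX _ => v vG.
by case/(link_crosses_side off)=> _ [|[]].
Qed.

Definition straddlers_see X a :=
  {in vertices Gs, forall v, straddles X (pred1 a) v -> link Gs v a}.

Lemma surgery_site1 X a c : two_coloured_off X (pred1 a) -> uniquely_crossed Hs X ->
  straddlers_see X a -> side X (pred1 a) c (linv a) -> surgery_site X (pred1 a) c.
Proof.
move=> off uX see_a aV; set A := pred1 a in off aV *.
have a_sees : {in vertices Gs, forall v, link Gs v a -> sees X A c v}.
  apply: count_leq_predI; rewrite -(nlab_count_link a sG).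
  have nside : ~~ side X A c (linv (linv a)) by rewrite linvK /side /A /= eqxx.
  apply: leq_trans (minimal aV nside) _; rewrite /capacity -!size_filter.
  apply: uniq_leq_size; first by rewrite filter_uniq // uniq_vertices.
  move=> v; rewrite !mem_filter => /andP[/(link_crosses_side off)[vc va] vG].
  by rewrite /= vc vG !andbT; case: va => [/(see_a _ vG)|[m /eqP->]].
split=> // [|v vG _ /eqP->]; last exact: a_sees.
apply: capacity_side_le1 uX _ => v vG /(link_crosses_side off)[vc [//|[_ /eqP-> va]]].
by rewrite (straddlesE _ _ c) vc a_sees.
Qed.

(* A coset straddling both of two opposite leaves has, at each of them, the direction of
   the other one. *)
Lemma opposite_straddlers_see X p u m v : tame X -> uniquely_crossed Hs X ->
  val p = rcons u m -> v \in vertices Gs -> straddles X (pred1 (head m u)) v ->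
  straddlers_see (translate X p) (linv m).
Proof.
move=> tX uX pE vG Xv v' v'G Xv'; have lj := vertex_index lab vG.
have lj' := vertex_index lab v'G; have [g vg] := vertex_coset lab vG.
have [g' vg'] := vertex_coset lab v'G; have crossg := straddles_crosses vG vg Xv.
have := straddles_crosses v'G vg' Xv'.
rewrite -[g'](mulgVK p) -conjugateM (crosses_conjugate _ p tX) => crossg'.
have [ej Kg'g] := uX _ _ _ _ lj' lj crossg' crossg.
have sK : subgroup (subgroup_at Hs v'.1) by exact: subgroup_generated.
have conjE : subgroup_at Hs v'.1 :^ (g' / p) = subgroup_at Hs v'.1 :^ g.
  by rewrite -{1}(mulgVK g (g' / p)) conjugate_mulr_mem.
apply/(vertex_link lab _ lj' vg'); rewrite -[g'](mulgVK p) -conjugateM conjE ej.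
have /andP[_ /existsP[l /andP[/sideP[nl _] vl]]] := Xv.
have gl : direction (subgroup_at Hs v.1 :^ g) l by apply/(vertex_link lab _ lj vg).
by apply: direction_away gl pE _; rewrite eq_sym.
Qed.

Lemma exists_leaf_straddlers_see X a : tame X -> uniquely_crossed Hs X -> leaf X a ->
  exists y a', leaf (translate X y) a' /\ straddlers_see (translate X y) a'.
Proof.
move=> tX uX lX.
have [[v vG Xv]|no] := pselect (exists2 v, v \in vertices Gs & straddles X (pred1 a) v).
  have [p [u [m [pE ha lp]]]] := exists_opposite_leaf tX lX.
  exists p, (linv m); split=> //; apply: opposite_straddlers_see tX uX pE vG _.
  by rewrite ha.
exists 1, a; rewrite translate1; split=> // v vG Xv.
by case: no; exists v.
Qed.

Lemma surgery X : tame X -> bichromatic X [::] -> uniquely_crossed Hs X ->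
  exists y A c, surgery_site (translate X y) A c /\
    (A = pred0 \/ exists2 a, A = pred1 a & leaf (translate X y) a).
Proof.
move=> tX bX uX; have [p [off|[a lp]]] := exists_leaf tX bX.
  exists p, pred0, true; split; last by left.
  exact: (surgery_site0 _ off (uniquely_crossed_translate tX uX)).
have tXp : tame (translate X p) := tame_mull p tX.
have uXp := uniquely_crossed_translate (y := p) tX uX.
have [q [a' []]] := exists_leaf_straddlers_see tXp uXp lp.
rewrite translateM => lq see_a'.
have [[all_side _] _] := lq; have [c aV] := all_side _ (linv_neq a').
exists (p * q), (pred1 a'), c; split; last by right; exists a'.
by apply: surgery_site1 see_a' aV; [case: lq | apply: uniquely_crossed_translate].
Qed.

Lemma surgery_cleaves X : tame X -> bichromatic X [::] -> uniquely_crossed Hs X ->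
  exists C, [/\ capacity C Gs <= 1, linv_closed C, exists l, C l &
                exists l, ~~ C l].
Proof.
move=> tX bX uX; have [y [A [c [[[_ both] cap1 _] _]]]] := surgery tX bX uX.
exists (side (translate X y) A (~~ c)); split=> //; first exact: capacity_le1_linv_closed.
by have [l /side_colour Xl] := both c; exists l; rewrite Xl.
Qed.

Lemma crosses_erase X A c j g : surgery_site X A c -> j < size Hs ->
  crosses (subgroup_at Hs j :^ g) (erase X A c) -> crosses (subgroup_at Hs j :^ g) X.
Proof.
move=> [off _ a_sees] lj; set K := _ :^ g => crossE.
have KA : meets K (fun h => cone A h && (X h == ~~ c)).
  apply: meets_sub (crossE (~~ c)); exists 0 => h _; rewrite /erase.
  by case: (cone A h) => //; case: (c).
suff Kc : meets K (fun h => X h == c).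
  move=> d; have [<- //|nd] := eqVneq c d.
  apply: meets_sub KA; exists 0 => h _ /andP[_ /eqP->].
  by case: (c) (d) nd => -[].
have : infinitely_many (fun h => (K h /\ X h == c) \/ (K h /\ cone (predC A) h)).
  have := crossE c; apply: infinitely_many_sub; apply: almost_allW (cone_predC A) => h ->.
  by rewrite /erase; case: (cone A h) => -[Kh Xh]; [left | right].
case/infinitely_many_or=> // /meets_cone[l nAl Kl].
have [Xl|Xl] := side_or c off nAl; first exact: meets_side Xl Kl.
have [a Aa Ka] : exists2 a, A a & direction K a.
  by apply/meets_cone; apply: meets_sub KA; exists 0 => h _ /andP[].
have [|x xg] := (coset_two_directions (lab.2 j lj) g).1.
  by exists l, a; split=> //; apply: contraNneq nAl => ->.
have /existsP[m /andP[Xm vm]] : sees X A c (j, x).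
  apply: (a_sees _ (at_coset_vertex lab lj xg) a Aa).
  exact/(vertex_link lab (v := (j, x)) _ lj xg).
by apply: meets_side Xm _; apply/(vertex_link lab (v := (j, x)) _ lj xg).
Qed.

Lemma uniquely_crossed_erase X A c : surgery_site X A c -> uniquely_crossed Hs X ->
  uniquely_crossed Hs (erase X A c).
Proof.
move=> site uX j j' g g' lj lj' crossg crossg'.
exact: uX lj lj' (crosses_erase site lj crossg) (crosses_erase site lj' crossg').
Qed.

Lemma uniquely_crossed_separating_rec n X (s : seq (free_group B)) : size s < n ->
  tame X -> bichromatic X [::] -> uniquely_crossed Hs X ->
  (forall g, branch X g -> g \in s) -> separating X.
Proof.
elim: n X s => // n IH X s; rewrite ltnS => sn tX bX uX branchX.
have [y [A [c [site cases]]]] := surgery tX bX uX.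
have [off cap1 _] := site; apply: (separating_translate (y := y)).
apply: separating_erase off (capacity_le1_linv_closed cap1) _.
case: cases => [->|[a eA leafa]].
  rewrite (_ : erase _ _ _ = fun=> c); first exact: separating_const.
  by apply: funext => g; rewrite /erase /cone; case: (val g).
rewrite eA in site *; pose s' := [seq y^-1 * g | g <- s].
have branchY g : branch (translate X y) g -> g \in s'.
  by move/branch_translate/branchX=> gs; apply/mapP; exists (y * g); rewrite ?mulKg.
have s'1 := branchY _ (leaf_branch leafa).
apply: (IH _ (rem 1 s')).
- have := s'1; rewrite -index_mem size_rem // size_map => /(leq_ltn_trans (leq0n _)) s_gt0.
  by rewrite prednK.
- exact/tame_erase/tame_mull.
- exact: bichromatic_erase leafa.2.
- exact: uniquely_crossed_erase site (uniquely_crossed_translate tX uX).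
move=> g /(branch_erase leafa)[g1 /branchY gs'].
by have := perm_to_rem s'1 => /perm_mem/(_ g); rewrite gs' inE (negbTE g1).
Qed.

Lemma uniquely_crossed_separating X : tame X -> bichromatic X [::] ->
  uniquely_crossed Hs X -> separating X.
Proof.
move=> tX bX uX; have [s branchX] := branch_finite tX.
exact: uniquely_crossed_separating_rec (leqnn _) tX bX uX branchX.
Qed.

End Surgery.

(** * Visible cleavings *)

Section Cleaving.
Variable B : finType.
Implicit Types (l m : letter B) (w : word B) (G : lgraph B) (E : pred B) (P : {set B}).
Implicit Types (x y z : nat) (Hs : seq (seq (word B))) (Gs : seq (lgraph B)).
Implicit Types (C : pred (letter B)).

Lemma conn_by_reads G E x y : conn_by G (fun e => E (elab e)) x y <->
  exists2 w, all (fun l => E l.1) w & reads G x w y.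
Proof.
split=> [[p [pE xy]]|[w wE /readsP[p [xy pw]]]].
  by exists (walk_label p); [rewrite all_map | apply/readsP; exists p].
by exists p; split=> //; rewrite -pw all_map in wE.
Qed.

Definition incident G E x :=
  has (fun e => E (elab e) && ((esrc e == x) || (etgt e == x))) (edges G).

Lemma incidentP G E x : incident G E x <-> exists2 l, E l.1 & in_link G x l.
Proof.
split=> [/hasP[e eG /andP[Ee /orP[]/eqP ex]]|[l El /hasP[e eG /andP[/eqP le /eqP ex]]]].
- by exists (elab e, false) => //; apply/hasP; exists e; rewrite //= /edge_end ex !eqxx.
- by exists (elab e, true) => //; apply/hasP; exists e; rewrite //= /edge_end ex !eqxx.
by apply/hasP; exists e; rewrite // le El -ex /edge_end; case: l.2; rewrite eqxx ?orbT.
Qed.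

Lemma step_incident G E x l y : step G x l y -> E l.1 -> incident G E x /\ incident G E y.
Proof.
move=> xy El; split; apply/incidentP; first by exists l => //; apply/in_linkP; exists y.
by exists (linv l) => //; apply/in_linkP; exists x; rewrite step_linv.
Qed.

Lemma incident_lt G E x : wf_graph G -> incident G E x -> x < nv G.
Proof. by move=> wG /incidentP[l _ /(in_link_lt wG)]. Qed.

Lemma edge_incident G E e : e \in edges G -> E (elab e) -> incident G E (esrc e).
Proof. by move=> eG Ee; apply/hasP; exists e; rewrite ?Ee ?eqxx. Qed.

Definition two_sided G E x := incident G E x && incident G (predC E) x.

Lemma link_crosses_two_sided Gs E v :
  link_crosses Gs (fun l => E l.1) v = two_sided (graph_at Gs v.1) E v.2.
Proof.
apply/link_crossesP/andP => [[l [m [lE mE vl vm]]]|].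
  by split; apply/incidentP; [exists l | exists m].
by case=> /incidentP[l lE vl] /incidentP[m mE vm]; exists l, m.
Qed.

Section CutVertex.
Variables (G : lgraph B) (E : pred B) (z : nat).
Hypothesis cut : forall x, two_sided G E x -> x = z.

Lemma reads_to_cut x w : (x == z) || incident G E x -> reads G x w z ->
  exists2 w', all (fun l => E l.1) w' & reads G x w' z.
Proof.
elim: w x => [|l w IH] x /=; first by move=> _ ->; exists [::].
case: eqP => [-> _ _|/eqP nxz /= Ex [y [xy yz]]]; first by exists [::].
have El : E l.1.
  apply: contraNT nxz => nEl; have [nEx _] := step_incident (E := predC E) xy nEl.
  by rewrite (@cut x) // /two_sided Ex nEx.
have [_ Ey] := step_incident xy El.
have [||w' w'E yz'] := IH y; rewrite ?Ey ?orbT //.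
by exists (l :: w'); [rewrite /= El | exists y].
Qed.

Lemma conn_by_cut x y : wf_graph G -> connected G -> z < nv G ->
  (x == z) || incident G E x -> (y == z) || incident G E y ->
  conn_by G (fun e => E (elab e)) x y.
Proof.
move=> wG conG lz; have to_cut t : (t == z) || incident G E t ->
    exists2 w : word B, all (fun l => E l.1) w & reads G t w z.
  move=> tE; have lt : t < nv G by case/orP: tE => [/eqP->|/incident_lt->].
  have [p [_ tz]] := conG t z lt lz.
  by apply: (reads_to_cut (w := walk_label p)) => //; apply/readsP; exists p.
move=> /to_cut[u uE xz] /to_cut[w wE yz]; apply/conn_by_reads; exists (u ++ winv w).
  by rewrite all_cat uE /winv all_rev all_map.
by apply/reads_cat; exists z; split=> //; apply: reads_winv.
Qed.

End CutVertex.

Lemma wedge_of_cut G P z : core_graph G -> z < nv G ->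
  (forall x, two_sided G (mem P) x -> x = z) -> wedge P G.
Proof.
move=> [wG fG conG dG] lz cut; exists z; split=> //; rewrite /=; split.
- move=> x lx; have [l [_ [_ xl _]]] := degree_gt1P _ fG (dG x lx).
  suff : incident G (mem P) x || incident G (predC (mem P)) x.
    by case/orP=> xP; apply/orP; [left | right]; apply/orP; right.
  have [lP|nlP] := boolP (l.1 \in P); apply/orP; [left | right];
  by apply/incidentP; exists l.
- by move=> x; case: eqP => [//|_] /= Px nPx; apply: cut; apply/andP.
- by move=> x y; apply: (conn_by_cut (E := mem P)).
move=> x y; apply: (conn_by_cut (E := predC (mem P))) => // t /andP[nPt nnPt].
by apply: cut; rewrite /two_sided nPt andbT; apply: sub_has nnPt => e /=; rewrite negbK.
Qed.

Lemma reads_incident G E x w y : (forall z, ~~ two_sided G E z) ->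
  reads G x w y -> incident G E x -> incident G E y.
Proof.
move=> no_cut; elim: w x => [|l w IH] x /=; first by move->.
case=> z [xz zy] Ex; apply: IH zy _; have El : E l.1.
  apply: contraT => nEl; have [nEx _] := step_incident (E := predC E) xz nEl.
  by have := no_cut x; rewrite /two_sided Ex nEx.
by case: (step_incident xz El).
Qed.

Lemma one_sided G E : wf_graph G -> connected G -> (forall x, ~~ two_sided G E x) ->
  all (fun e => E (elab e)) (edges G) \/ all (fun e => ~~ E (elab e)) (edges G).
Proof.
move=> wG conG no_cut.
have [|/allPn[e' e'G nEe']] := boolP (all (fun e => E (elab e)) (edges G)); first by left.
right; apply/allPn => -[e eG /negPn Ee].
have Ex := edge_incident eG Ee; have nEx' := edge_incident (E := predC E) e'G nEe'.
have [p [_ walk]] := conG _ _ (incident_lt wG Ex) (incident_lt wG nEx').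
have reads_p : reads G (esrc e) (walk_label p) (esrc e') by apply/readsP; exists p.
by have := no_cut (esrc e'); rewrite /two_sided nEx' (reads_incident no_cut reads_p).
Qed.

Lemma visibly_cleaved_capacity Gs : visibly_cleaved Gs ->
  exists P, [/\ P != set0, ~: P != set0 & capacity (fun l => l.1 \in P) Gs <= 1].
Proof.
case=> P [P0 PC0 [i0 [_ [z [_ [_ cut _ _]]] sides]]]; exists P; split=> //.
have at_wedge v : v \in vertices Gs ->
    link_crosses Gs (fun l => l.1 \in P) v -> v = (i0, z).
  case: v => i x; rewrite mem_vertices => /andP[li _].
  rewrite (link_crosses_two_sided _ (mem P)) => /andP[/= Px nPx].
  have [ei|ni] := eqVneq i i0.
    by rewrite ei in Px nPx *; rewrite (cut x) //; apply/orP; right.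
  case: (sides i li ni) => /allP one_side.
    by case/hasP: nPx => e /one_side eP /andP[]; rewrite /= eP.
  by case/hasP: Px => e /one_side neP /andP[/= eP]; rewrite eP in neP.
rewrite leqNgt; apply/count_gt1P => [|[v [v' [nvv' vG v'G vP v'P]]]].
  exact: uniq_vertices.
by case/eqP: nvv'; rewrite (at_wedge v vG vP) (at_wedge v' v'G v'P).
Qed.

Lemma capacity_le1_cut Gs C v : capacity C Gs <= 1 -> v \in vertices Gs ->
  exists2 v0, v0 \in vertices Gs &
    {in vertices Gs, forall v', link_crosses Gs C v' -> v' = v0}.
Proof.
move=> cap1 vG.
have [/hasP[v0 v0G v0C]|/hasPn none] := boolP (has (link_crosses Gs C) (vertices Gs)).
  by exists v0 => // v' v'G v'C; apply: (count_le1_eq (uniq_vertices Gs) cap1).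
by exists v => // v' /none/negP.
Qed.

Lemma capacity_visibly_cleaved Hs Gs P : sigma_seq Hs Gs -> (exists v, v \in vertices Gs) ->
  P != set0 -> ~: P != set0 -> capacity (fun l => l.1 \in P) Gs <= 1 -> visibly_cleaved Gs.
Proof.
move=> [sz core] [v vG] P0 PC0 cap1; have [[i0 z] + cut] := capacity_le1_cut cap1 vG.
rewrite mem_vertices => /andP[li0 lz]; exists P; split=> //; exists i0.
have core_at i : i < size Gs -> core_graph (graph_at Gs i).
  by rewrite sz => /core[].
have cut_at i x : i < size Gs -> two_sided (graph_at Gs i) (mem P) x -> (i, x) = (i0, z).
  move=> li xP; have [wG _ _ _] := core_at i li; have /andP[Px _] := xP.
  apply: cut; first by rewrite mem_vertices li (incident_lt wG Px).
  by rewrite (link_crosses_two_sided _ (mem P)).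
split=> // [|i li ni].
  by apply: (wedge_of_cut (core_at _ li0) lz) => x /(cut_at _ _ li0)[].
have [wG _ conG _] := core_at i li; apply: (one_sided (E := mem P)) => // x.
by apply/negP => /(cut_at _ _ li)[ei _]; rewrite ei eqxx in ni.
Qed.

Lemma linv_closed_labels C : linv_closed C -> C = (fun l => l.1 \in [set b | C (b, false)]).
Proof.
move=> Cinv; apply: funext => -[b s]; rewrite inE /=; case: s => //.
by apply/idP/idP => /Cinv.
Qed.

End Cleaving.

(** * Gersten representatives *)

Section Gersten.
Variable B : finType.
Local Open Scope group_scope.
Implicit Types (a beta : B -> word B) (Hs : seq (seq (word B))) (Gs : seq (lgraph B)).
Implicit Types (C : pred (letter B)).

Lemma exists_uniquely_crossed_pullback beta a Hs Ga C l m : is_aut beta -> is_aut a ->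
  sigma_seq (aut_act a Hs) Ga -> capacity C Ga <= 1 -> C l -> ~~ C m ->
  exists f f' : endomorphism B,
  [/\ cancel f f', cancel f' f, tame (cone C \o f), bichromatic (cone C \o f) [::] &
      uniquely_crossed (aut_act beta Hs) (cone C \o f)].
Proof.
move=> /is_autP[beta' [bK b'K]] /is_autP[a' [aK a'K]] sGa cap1 Cl nCm.
pose f := substg a \o substg beta'; pose f' := substg beta \o substg a'.
have fK : cancel f f' by move=> g; rewrite /f /f' /= aK b'K.
have f'K : cancel f' f by move=> g; rewrite /f /f' /= bK a'K.
exists f, f'; split=> //.
- exact: tame_morphism fK (tame_cone C).
- have proper_f' : proper_map f' := proper_cancel f'K.
  move=> c; apply: (infinitely_many_comp proper_f').
  have [k Ck] : exists k, C k = c by case: c; [exists l | exists m; apply: negbTE].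
  apply: infinitely_manyW (infinitely_many_starts1 k) => g kg.
  split; first exact: prefix0s.
  by rewrite -Ck -(cone_starts C kg) -[in RHS](f'K g).
have [at_coset lab] := sequence_labelling_exists sGa.
apply: (uniquely_crossed_transport fK f'K _ _ (uniquely_crossed_cone lab cap1)).
  by rewrite !size_map.
move=> j; rewrite (subgroup_at_aut_act aK a'K) (subgroup_at_aut_act bK b'K).
by apply: funext => g; rewrite /f' /= bK.
Qed.

Section MinimalRepresentative.
Variables (beta : B -> word B) (Hs : seq (seq (word B))) (Gs : seq (lgraph B)).
Hypotheses (gb : gersten beta Hs) (sG : sigma_seq (aut_act beta Hs) Gs).
Hypothesis minlex_gt1 : forall b : B, 1 < nlab b Gs.
Variables (a : B -> word B) (Ga : seq (lgraph B)).
Hypotheses (aut_a : is_aut a) (sGa : sigma_seq (aut_act a Hs) Ga).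

Let minimal : whitehead_minimal Gs := gersten_whitehead_minimal gb sG.

Lemma minlex_gt1_orbit b : 1 < nlab b Ga.
Proof.
rewrite ltnNge; apply/negP; have [at_coset lab] := sequence_labelling_exists sGa.
rewrite (nlab_capacity lab (b, false) sGa) => cap1.
have bV_other : ~~ pred1 (b, false) (b, true) by rewrite /= xpair_eqE andbF.
have [f [f' [fK f'K tX bX uX]]] :=
  exists_uniquely_crossed_pullback gb.1 aut_a sGa cap1 (eqxx _) bV_other.
have [at_coset' lab'] := sequence_labelling_exists sG.
apply: (not_separating_starts (l := (b, false)) fK f'K).
have -> : starts [:: (b, false)] \o f = cone (pred1 (b, false)) \o f.
  by apply: funext => g; rewrite /= cone1.
exact: uniquely_crossed_separating sG lab' minimal minlex_gt1 _ tX bX uX.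
Qed.

Lemma visibly_cleaved_minimal : visibly_cleaved Ga -> visibly_cleaved Gs.
Proof.
case/visibly_cleaved_capacity=> P [/set0Pn[b bP] /set0Pn[b' b'P] cap1]; rewrite inE in b'P.
have [f [f' [_ _ tX bX uX]]] := exists_uniquely_crossed_pullback
  (l := (b, false)) (m := (b', false)) gb.1 aut_a sGa cap1 bP b'P.
have [at_coset lab] := sequence_labelling_exists sG.
have [C [capC Cinv [l Cl] [m nCm]]] := surgery_cleaves sG lab minimal minlex_gt1 tX bX uX.
rewrite (linv_closed_labels Cinv) in capC Cl nCm; apply: (capacity_visibly_cleaved sG) capC.
- have := ltnW (minlex_gt1 b); rewrite (nlab_count_link (b, false) sG) -has_count.
  by case/hasP=> v vG _; exists v.
- by apply/set0Pn; exists l.1.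
by apply/set0Pn; exists m.1; rewrite inE.
Qed.

End MinimalRepresentative.

End Gersten.

Theorem lemma9p17 (B : finType) (Hs : seq (seq (word B))) :
  (exists beta, gersten beta Hs /\
     exists Gs, sigma_seq (aut_act beta Hs) Gs /\ forall b : B, 1 < nlab b Gs) ->
  [<-> (exists a, is_aut a /\
          exists Gs, sigma_seq (aut_act a Hs) Gs /\ visibly_cleaved Gs);
       (exists beta, gersten beta Hs /\
          exists Gs, sigma_seq (aut_act beta Hs) Gs /\ visibly_cleaved Gs);
       (forall beta, gersten beta Hs ->
          forall Gs, sigma_seq (aut_act beta Hs) Gs -> visibly_cleaved Gs)].
Proof.
case=> beta [gb [Gs [sG minlex_gt1]]]; tfae.
- move=> [a [aut_a [Ga [sGa cleaved_a]]]]; exists beta; split=> //; exists Gs; split=> //.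
  exact: (visibly_cleaved_minimal gb sG minlex_gt1 aut_a sGa cleaved_a).
- move=> [beta1 [[aut1 _] [Gs1 [sGs1 cleaved1]]]] beta2 gb2 Gs2 sGs2.
  have minlex_gt1' := minlex_gt1_orbit gb sG minlex_gt1 gb2.1 sGs2.
  exact: (visibly_cleaved_minimal gb2 sGs2 minlex_gt1' aut1 sGs1 cleaved1).
move=> cleaved; exists beta; split; first exact: gb.1.
by exists Gs; split=> //; apply: cleaved gb _ sG.
Qed.
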